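(* Assume that $1<q\le p\le\infty$, $0<\gamma<\frac{d}{q}$ and $-\frac{d}{q}\le\beta<-\gamma$. Let $\phi\in\mathcal{G}_{q,p}$ be such that there is a constant $C>0$ with $$\int_{r}^{\infty}\phi^{q}(t)\,t^{\frac{dq}{p}-1}\,dt\le C\,\phi^{q}(r)\,r^{\frac{dq}{p}}\quad\text{for every } r>0,$$ and such that there is a constant $C'>0$ with $\phi(r)\le C' r^{\beta}$ for every $r>0$. Put $$\frac{1}{\bar p}=\frac1p\left(1+\frac{\gamma}{\beta}\right)\quad\text{and}\quad \frac{1}{\bar q}=\frac1q\left(1+\frac{\gamma}{\beta}\right),$$ and $\psi(r)=(\phi(r))^{\frac{q}{\bar q}}$ for $r>0$. Then there is a constant $K>0$ such that for all $f\in(L^{q},L^{p})^{\phi}(\mathbb{R}^{d})$, $$\|M_{\gamma}f\|_{(L^{\bar q},L^{\bar p})^{\psi}(\mathbb{R}^{d})}\le K\,\|f\|_{(L^{q},L^{p})^{\phi}(\mathbb{R}^{d})}.$$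
   Context: Convention: $\frac1\infty=0$. $L^{0}(\mathbb{R}^{d})$ is the space of (a.e. equivalence classes of) Lebesgue measurable complex-valued functions on $\mathbb{R}^d$; $B(y,r)$ is the open ball with center $y\in\mathbb{R}^d$ and radius $r>0$. For $1\le q\le p\le\infty$, $\mathcal{G}_{q,p}$ is the set of all functions $\phi:(0,\infty)\to(0,\infty)$ such that $t\mapsto\phi(t)t^{d/p}$ is almost decreasing (there is $C>0$ with $\phi(s)s^{d/p}\le C\phi(r)r^{d/p}$ whenever $0<r\le s<\infty$) and $t\mapsto\phi(t)t^{d/q}$ is almost increasing (there is $C>0$ with $\phi(r)r^{d/q}\le C\phi(s)s^{d/q}$ whenever $0<r\le s<\infty$). For $r>0$ and $f\in L^0(\mathbb{R}^d)$, put ${}_{r}\|f\|_{q,p}=\left\|\left[\int_{\mathbb{R}^d}|f\chi_{B(y,r)}|^{q}(x)\,dx\right]^{1/q}\right\|_{p}$, the $L^{p}(\mathbb{R}^d)$-norm being taken in the variable $y$ (usual modification if $q=\infty$). For $\phi\in\mathcal{G}_{q,p}$ the generalized Fofana space $(L^{q},L^{p})^{\phi}(\mathbb{R}^{d})$ is the set of all $f\in L^{0}(\mathbb{R}^{d})$ with $$\|f\|_{(L^{q},L^{p})^{\phi}(\mathbb{R}^{d})}=\sup_{r>0}\frac{1}{\phi(r)}\,r^{d(-\frac1q-\frac1p)}\;{}_{r}\|f\|_{q,p}<\infty.$$ For $0<\gamma<d$, the fractional maximal operator is $M_{\gamma}f(x)=\sup_{r>0}|B(x,r)|^{\frac{\gamma}{d}-1}\int_{B(x,r)}|f(y)|\,dy$,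 $x\in\mathbb{R}^d$, for locally integrable $f$ on $\mathbb{R}^d$, where $|B(x,r)|$ is Lebesgue measure. *)

(* Defs.v *)
From HB Require Import structures.
From mathcomp Require Import all_boot all_order all_algebra.
From mathcomp Require Import all_classical all_reals all_analysis.
From mathcomp Require Import complex.
Set Implicit Arguments.
Unset Strict Implicit.
Unset Printing Implicit Defensive.
Import Order.TTheory GRing.Theory Num.Theory.
Import numFieldNormedType.Exports.
Local Open Scope classical_set_scope.
Local Open Scope ring_scope.

Section lebesgue_measure_Rd.
Context {R : realType} {d : nat}.
Implicit Types (a b : 'rV[R]_d) (A : set 'rV[R]_d).

Definition box a b : set 'rV[R]_d :=
  [set x | forall i, a ord0 i < x ord0 i <= b ord0 i].

Definition box_volume a b : \bar R :=
  (\prod_(i < d) Num.max 0 (b ord0 i - a ord0 i))%:E.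

(* Covers are at most countable: [P] selects the boxes in use, so that the
   empty set has outer measure 0 in dimension 0 as well. *)
Definition lebesgue_outer A : \bar R :=
  ereal_inf [set v | exists (P : pred nat) (a b : nat -> 'rV[R]_d),
    A `<=` \bigcup_(k in [set k | P k]) box (a k) (b k) /\
    v = (\sum_(0 <= k <oo | P k) box_volume (a k) (b k))%E].

Lemma box_volume_ge0 a b : (0 <= box_volume a b)%E.
Proof. by rewrite lee_fin prodr_ge0// => i _; rewrite le_max lexx. Qed.

Lemma lebesgue_outer_ge0 A : (0 <= lebesgue_outer A)%E.
Proof.
apply: le_ereal_inf_tmp => _ [P [a [b [_ ->]]]].
by apply: nneseries_ge0 => k _ _; exact: box_volume_ge0.
Qed.

Lemma lebesgue_outer0 : lebesgue_outer set0 = 0%E.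
Proof.
apply/eqP; rewrite eq_le lebesgue_outer_ge0 andbT.
apply: ereal_inf_lbound; exists pred0, (fun=> 0), (fun=> 0); split => //.
by rewrite eseries_pred0.
Qed.

Lemma le_lebesgue_outer :
  {homo lebesgue_outer : A B / A `<=` B >-> (A <= B)%E}.
Proof.
move=> A B AB; apply/ereal_inf_le_tmp => _ [P [a [b [BP ->]]]].
by exists P, a, b; split => //; exact: subset_trans AB BP.
Qed.

Lemma lebesgue_outer_sigma_subadditive : sigma_subadditive lebesgue_outer.
Proof.
move=> A; have [[i ioo]|] := pselect (exists i, lebesgue_outer (A i) = +oo%E).
  rewrite (eseries_pinfty _ _ ioo) ?leey// => n _.
  by rewrite -ltNye (lt_le_trans _ (lebesgue_outer_ge0 _)).
rewrite -forallNE => Aoo.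
suff add2e (e : {posnum R}) : (lebesgue_outer (\bigcup_n A n) <=
    \sum_(i <oo) lebesgue_outer (A i) + e%:num%:E)%E.
  by apply/lee_addgt0Pr => _/posnumP[].
rewrite (le_trans _ (epsilon_trick _ _ _))//; last first.
  by move=> n; exact: lebesgue_outer_ge0.
pose bx := (bool * ('rV[R]_d * 'rV[R]_d))%type.
pose vol (c : bx) : \bar R := if c.1 then box_volume c.2.1 c.2.2 else 0%E.
pose bset (c : bx) : set 'rV[R]_d := if c.1 then box c.2.1 c.2.2 else set0.
have vol_ge0 c : (0 <= vol c)%E.
  by rewrite /vol; case: ifP => // _; exact: box_volume_ge0.
pose P n (B : nat -> bx) := A n `<=` \bigcup_k bset (B k) /\
  (\sum_(k <oo) vol (B k) <= lebesgue_outer (A n) +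
    (e%:num / (2 ^ n.+1)%:R)%:E)%E.
have [G PG] : {G : nat -> nat -> bx & forall n, P n (G n)}.
  apply: (@choice _ _ P) => n; rewrite /P.
  have en1 : 0 < e%:num / (2 ^ n.+1)%:R by [].
  have : lebesgue_outer (A n) \is a fin_num.
    by rewrite ge0_fin_numE ?lebesgue_outer_ge0// ltey; apply/eqP/Aoo.
  move=> /(lb_ereal_inf_adherent en1)[_ [Q [a [b [AQ ->]]]] /ltW lt].
  exists (fun k => (Q k, (a k, b k))); split.
    move=> x /AQ[k /= Qk xk]; exists k => //.
    by rewrite /bset/= Qk.
  apply: le_trans lt; rewrite [leRHS]eseries_mkcond.
  by apply: lee_nneseries => // k _; rewrite vol_ge0.
have volG_ge0 x : (0 <= (vol \o uncurry G) x)%E by exact: vol_ge0.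
apply: (@le_trans _ _ (\esum_(i in setT) (vol \o uncurry G) i)%E).
  apply: ereal_inf_lbound => /=.
  have /card_esym/ppcard_eqP[f] := card_nat2.
  exists (fun k => (uncurry G (f k)).1), (fun k => (uncurry G (f k)).2.1),
    (fun k => (uncurry G (f k)).2.2); split.
    move=> t [i _ /((PG i).1)[j _]]; rewrite /bset; case: ifPn => // Gij1 Gij.
    by exists (f^-1%FUN (i, j)) => /=; rewrite invK ?inE.
  rewrite eseries_mkcond.
  transitivity (\sum_(k <oo) (vol \o uncurry G) (f k))%E; last first.
    by apply: eq_eseriesr.
  rewrite -(esum_pred_image (vol \o uncurry G) f xpredT)//.
    congr esum; apply/seteqP; split=> // x _.
    by exists (f^-1%FUN x); rewrite ?invK ?inE.
  by move=> i j _ _ fij; apply: (@inj _ _ setT f); rewrite ?inE.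
rewrite [leLHS](_ : _ = \sum_(i <oo) \sum_(j <oo) vol (G i j))%E; last first.
  pose J : nat -> set (nat * nat) := fun i => [set (i, j) | j in setT].
  rewrite (_ : setT = \bigcup_k J k); last first.
    by rewrite predeqE => -[a b]; split => // _; exists a => //; exists b.
  rewrite esum_bigcupT /=; last 2 first.
    - apply/trivIsetP => i j _ _ ij.
      rewrite predeqE => -[n m] /=; split => //= -[] [_] _ [<-{n} _].
      by move=> [m' _] [] /esym/eqP; rewrite (negbTE ij).
    - by move=> /= [n m]; exact: vol_ge0.
  rewrite -(image_id [set: nat]) -fun_true esum_pred_image//; last first.
    by move=> n _; exact: esum_ge0.
  apply: eq_eseriesr => /= j _.
  rewrite -(esum_pred_image (vol \o uncurry G) (pair j) predT)//=; last first.
    by move=> ? ? _ _; exact: (@can_inj _ _ _ snd).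
  by congr esum; rewrite predeqE => -[a b]; split; move=> [i _ <-]; exists i.
apply: lee_nneseries => [n _|n _]; last exact: (PG n).2.
by move=> _; apply: nneseries_ge0.
Qed.

HB.instance Definition _ := isOuterMeasure.Build R 'rV[R]_d lebesgue_outer
  lebesgue_outer0 lebesgue_outer_ge0 le_lebesgue_outer
  lebesgue_outer_sigma_subadditive.

End lebesgue_measure_Rd.

(* The Caratheodory sigma-algebra of [lebesgue_outer] is that of the Lebesgue
   (not only Borel) measurable sets. *)
Definition Rd (R : realType) (d : nat) :=
  caratheodory_type
    [the {outer_measure set 'rV[R]_d -> \bar R} of @lebesgue_outer R d].

HB.instance Definition _ (R : realType) (d : nat) := Measurable.on (Rd R d).

Definition lebesgue_Rd (R : realType) (d : nat) : set (Rd R d) -> \bar R :=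
  @lebesgue_outer R d.

HB.instance Definition _ (R : realType) (d : nat) := isMeasure.Build _ _ _
  (@lebesgue_Rd R d)
  (@caratheodory_measure0 _ _ (@lebesgue_outer R d))
  (@caratheodory_measure_ge0 _ _ (@lebesgue_outer R d))
  (@caratheodory_measure_sigma_additive _ _ (@lebesgue_outer R d)).

Section fofana.
Context {R : realType} {d : nat}.
Implicit Types (x y : 'rV[R]_d) (r t : R) (p q : \bar R) (phi : R -> R).
Local Notation T := (Rd R d).
Local Notation mu := (@lebesgue_Rd R d).

(* Euclidean: the norm and [ball] of ['rV_d] are those of the sup norm. *)
Definition eball y r : set T :=
  [set x : 'rV[R]_d |
    Num.sqrt (\sum_(i < d) (x ord0 i - y ord0 i) ^+ 2) < r].

(* 1 / p, with 1 / +oo = 0 *)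
Definition recip p : R := fine p^-1%E.

Definition almost_decreasing (g : R -> R) :=
  exists2 C : R, 0 < C & forall r s, 0 < r -> r <= s -> g s <= C * g r.

Definition almost_increasing (g : R -> R) :=
  exists2 C : R, 0 < C & forall r s, 0 < r -> r <= s -> g r <= C * g s.

(* Only the restriction of [phi] to the positive reals is meaningful. *)
Definition Gclass q p phi :=
  [/\ forall t, 0 < t -> 0 < phi t,
      almost_decreasing (fun t => phi t * t `^ (d%:R * recip p)) &
      almost_increasing (fun t => phi t * t `^ (d%:R * recip q))].

Definition amalgam_norm q p r (g : T -> \bar R) : \bar R :=
  'N[mu]_p[(fun y => 'N[mu]_q[g \_ (eball y r)])]%E.

Definition fofana_norm q p phi (g : T -> \bar R) : \bar R :=
  ereal_sup [set (((phi r)^-1 * r `^ (d%:R * (- recip q - recip p)))%:E *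
                  amalgam_norm q p r g)%E | r in `]0, +oo[%classic].

Definition modulus (f : T -> R[i]) : T -> \bar R :=
  fun x => (ComplexField.Normc.normc (f x))%:E.

Definition L0 : set (T -> R[i]) :=
  [set f | measurable_fun [set: T] (fun x : T => complex.Re (f x)) /\
           measurable_fun [set: T] (fun x : T => complex.Im (f x))].

Definition fofana q p phi : set (T -> R[i]) :=
  [set f | L0 f /\ (fofana_norm q p phi (modulus f) < +oo)%E].

Definition frac_maximal (gamma : R) (f : T -> R[i]) : T -> \bar R :=
  fun x => ereal_sup
    [set (mu (eball x r) `^ (gamma / d%:R - 1) *
          \int[mu]_(y in eball x r) modulus f y)%E | r in `]0, +oo[%classic].

End fofana.

Arguments Gclass {R} d q p phi.

(* Main.v *)
Require Import Defs.
From mathcomp Require Import all_boot all_order all_algebra.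
From mathcomp Require Import all_classical all_reals all_analysis.
From mathcomp Require Import complex.
From mathcomp Require Import ess_sup_inf measurable_realfun ring lra.
Import Order.TTheory GRing.Theory Num.Theory.
Import numFieldNormedType.Exports.
Import HBNNSimple.
Set Implicit Arguments.
Unset Strict Implicit.
Unset Printing Implicit Defensive.
Local Open Scope classical_set_scope.
Local Open Scope ring_scope.

(* Let [h = |f|], [theta = - gamma / beta], and let [M h] be the supremum over
   [r > 0] of [r ^- d * \int_(B(x, r)) h].  Since [phi r <= C' r^beta], Hoelder's
   inequality bounds the averages of [h] over balls of radius [r] by a multiple
   of [||f|| r^beta], and writing such an average as the product of its powers
   [1 - theta] and [theta] gives the pointwise estimate
   [M_gamma f <= C ||f||^theta (M h)^(1 - theta)].  Taking norms, everything
   reduces to the boundedness of [M] on [(L^q, L^p)^phi].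
   For the latter, split [h] at the ball [B(y, 2r)].  The inner part is controlled
   by the strong type [(q, q)] of [M]; on [B(y, r)] the maximal function of the
   outer part is at most a multiple of
   [sup_k ((2^k r)^-d \int_(B(y, 2^k r)) h^q)^(1/q)].  When [p] is finite the
   [p]-th power of this supremum is at most the sum over [k] of the [p]-th powers,
   whose integrals in [y] are summable by the integral condition on [phi]; when
   [p = +oo] the terms are bounded one by one, [phi] being almost decreasing. *)

(** The exponents are forced by the pointwise estimate. With tau = 1 - theta, the choices 1 / qbar =
    tau / q and 1 / pbar = tau / p turn the mixed norm of (M h)^tau into the tau-th power of the (q,
    p) mixed norm of M h, and psi = phi^tau is the matching weight; beta < - gamma < 0 puts theta
    strictly between 0 and 1. Lebesgue measure is given as an outer measure built from boxes, so
    measurability and volume of balls are derived from coverings, the volume up to factors depending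
    on d. Sup-norm cubes carry the covering argument and Euclidean balls are compared with them. Two
    maximal functions coexist. M h is estimated without proving it measurable, whereas an uncentred
    supremum over countably many cubes is measurable by construction, and the strong type is proved
    for the latter. Upper bounds for integrals of M h and M_gamma f then use monotonicity of the
    integral alone. The local integrals of h^q over B(y, t) do have to be measurable in y, so that
    the sum over dyadic radii can be integrated term by term. *)

(* The integral of a nonnegative function is a supremum over the simple functions
   below it, measurable or not, hence monotone without measurability. *)
Lemma le_integral_nonmeasurable d (T : measurableType d) (R : realType)
    (mu : {measure set T -> \bar R}) (D : set T) (f g : T -> \bar R) :
  (forall x, D x -> (0 <= f x)%E) -> (forall x, D x -> (f x <= g x)%E) ->
  (\int[mu]_(x in D) f x <= \int[mu]_(x in D) g x)%E.
Proof.
move=> f0 fg; rewrite !(integral_mkcond D).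
have f0' x : (0 <= (f \_ D) x)%E by apply: erestrict_ge0.
have fg' x : ((f \_ D) x <= (g \_ D) x)%E.
  by rewrite /patch; case: ifP => // /set_mem; exact: fg.
have g0' x : (0 <= (g \_ D) x)%E by exact: le_trans (fg' x).
rewrite !ge0_integralTE//; apply: ge_ereal_sup => _ [h /= hf <-].
by apply: ereal_sup_ubound; exists h => //= x; exact: le_trans (hf x) (fg' x).
Qed.

(** * Measurability in the Caratheodory sigma-algebra *)

Section measurability.
Context {R : realType} {d : nat}.
Local Notation T := (Rd R d).
Local Notation mu := (@lebesgue_Rd R d).

(** The hyperplane x_i = c cuts a half-open box into two half-open boxes. Truncating side lengths at
    0 keeps the identity true when the hyperplane misses the box or the box is empty. *)
Lemma box_volume_split (a b : 'rV[R]_d) (i : 'I_d) (c : R) :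
  box_volume a b =
  (box_volume a (\row_j if j == i then Num.min (b ord0 i) c else b ord0 j) +
   box_volume (\row_j if j == i then Num.max (a ord0 i) c else a ord0 j) b)%E.
Proof.
rewrite /box_volume -EFinD; congr EFin.
rewrite (bigD1 i)//= [in RHS](bigD1 i)//= [X in _ = _ + X](bigD1 i)//=.
rewrite !mxE eqxx.
under [X in _ = _ * X + _]eq_bigr => j ji do rewrite mxE (negbTE ji).
under [X in _ = _ + _ * X]eq_bigr => j ji do rewrite mxE (negbTE ji).
rewrite -mulrDl; congr (_ * _).
rewrite /Num.max /Num.min; do ! case: ifP; lra.
Qed.

(** Caratheodory's criterion: cutting every box of a cover of [X] along x_i = c yields covers of the
    two parts of [X] with the same total volume. *)
Lemma measurable_halfspace (i : 'I_d) (c : R) :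
  measurable ([set x : 'rV[R]_d | c < x ord0 i] : set T).
Proof.
apply: le_caratheodory_measurable => X.
apply: le_ereal_inf_tmp => _ [P [a [b [XP ->]]]].
under eq_eseriesr => k _ do rewrite (box_volume_split (a k) (b k) i c).
rewrite nneseriesD; [|by move=> *; exact: box_volume_ge0..].
rewrite addeC; apply: leeD; apply: ereal_inf_lbound.
- exists P, a, (fun k => \row_j if j == i then Num.min (b k ord0 i) c
    else b k ord0 j); split=> // x [/XP[k Pk xk] /= cx].
  exists k => // j; rewrite mxE; case: eqP => [->|_]; last exact: xk.
  by have /andP[-> h] := xk i; rewrite le_min h leNgt; apply/negP.
- exists P, (fun k => \row_j if j == i then Num.max (a k ord0 i) c
    else a k ord0 j), b; split=> // x [/XP[k Pk xk] cx].
  exists k => // j; rewrite mxE; case: eqP => [->|_]; last exact: xk.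
  by have /andP[h ->] := xk i; rewrite gt_max h cx.
Qed.

Lemma measurable_coord (i : 'I_d) :
  measurable_fun [set: T] (fun x : T => (x : 'rV[R]_d) ord0 i).
Proof.
apply: (measurability _ (RGenOInfty.measurableE R)).
move=> _ [_ [c ->] <-]; rewrite setTI.
rewrite [X in measurable X](_ : _ = [set x : 'rV[R]_d | c < x ord0 i]).
  exact: measurable_halfspace.
by apply/seteqP; split=> x /=; rewrite in_itv/= andbT.
Qed.

Lemma measurable_eball (y : 'rV[R]_d) (r : R) :
  measurable (eball y r : set T).
Proof.
have mS : measurable_fun [set: T]
    (fun x : T => \sum_(i < d) ((x : 'rV[R]_d) ord0 i - y ord0 i) ^+ 2).
  apply: measurable_sum => i.
  apply: measurable_funX.
  exact: measurable_funB (measurable_coord i) (measurable_cst _).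
rewrite /eball.
case: (ltP 0 r) => r0; last first.
  rewrite (_ : [set _ | _] = set0)//; apply/seteqP; split=> x //=.
  by rewrite ltNge (le_trans r0)// sqrtr_ge0.
have rE S : (Num.sqrt S < r) = (S < r ^+ 2).
  by rewrite -{1}(gtr0_norm r0) -sqrtr_sqr ltr_sqrt ?exprn_gt0.
have := mS measurableT _ (measurable_itv `]-oo, (r ^+ 2)[).
rewrite setTI; congr (measurable _).
by apply/seteqP; split=> x /=; rewrite in_itv/= rE.
Qed.

(** Inclusions between cubes are checked one coordinate at a time; [eball_cube] and [cube_eball]
    carry the results over to Euclidean balls. *)
Definition cube (y : 'rV[R]_d) (r : R) : set T :=
  [set x : 'rV[R]_d | forall i, `|x ord0 i - y ord0 i| < r].

Lemma measurable_cube (y : 'rV[R]_d) (r : R) : measurable (cube y r).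
Proof.
have -> : cube y r = \bigcap_(i in [set: 'I_d])
    [set x : 'rV[R]_d | `|x ord0 i - y ord0 i| < r].
  by apply/seteqP; split=> [x xy i _|x xy i]; [exact: xy|exact: (xy i)].
apply: fin_bigcap_measurable => // i _.
have mS : measurable_fun [set: T]
    (fun x : T => `|(x : 'rV[R]_d) ord0 i - y ord0 i|).
  apply: (measurableT_comp (@normr_measurable R setT)).
  exact: measurable_funB (measurable_coord i) (measurable_cst _).
have := mS measurableT _ (measurable_itv `]-oo, r[).
by rewrite setTI.
Qed.

Lemma rational_approx (x : 'rV[R]_d) (e : R) : 0 < e ->
  exists v : 'rV[rat]_d, cube x e (map_mx ratr v).
Proof.
move=> e0.
have /choice[f fP] (i : 'I_d) : exists q : rat, `|ratr q - x ord0 i| < e.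
  have /rat_in_itvoo[q] : x ord0 i - e < x ord0 i + e by lra.
  by rewrite in_itv/= => /andP[h1 h2]; exists q; rewrite ltr_norml; lra.
by exists (\row_i f i) => i; rewrite !mxE.
Qed.

(** Such a set is the union of the cubes with rational centre and radius 1 / (n + 1) that it
    contains, a countable family. *)
Lemma open_cube_measurable (U : set 'rV[R]_d) :
  (forall x, U x -> exists2 e : R, 0 < e & cube x e `<=` U) ->
  measurable (U : set T).
Proof.
move=> oU.
pose F (k : 'rV[rat]_d * nat) : set T :=
  let Q := cube (map_mx ratr k.1) k.2.+1%:R^-1 in
  if asbool (Q `<=` U) then Q else set0.
rewrite (_ : U = \bigcup_k F k); last first.
  apply/seteqP; split=> [x Ux|x [k _]]; last first.
    by rewrite /F; case: asboolP => // h; exact: h.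
  have [e e0 eU] := oU _ Ux.
  (* Half of [e]: a cube of this radius that contains [x] has all its points within twice the radius
     of [x], hence in [cube x e]. *)
  have [n] : exists n : nat, n.+1%:R^-1 < e / 2.
    have e20 : 0 < e / 2 by rewrite divr_gt0.
    have [n _ /(_ n (leqnn n))] := near_infty_natSinv_lt (PosNum e20).
    by exists n.
  move=> ne; have n0 : 0 < n.+1%:R^-1 :> R by rewrite invr_gt0.
  have [v vx] := rational_approx x n0.
  exists (v, n) => //; rewrite /F/= asboolT.
    by move=> i; rewrite distrC; exact: vx.
  move=> z /= zv; apply: eU => i.
  move: (n.+1%:R^-1) ne n0 vx zv => w ne n0 vx zv.
  have := zv i; have := vx i; rewrite !ltr_norml => /andP[h1 h2] /andP[h3 h4].
  by apply/andP; split; lra.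
apply: countable_bigcupT_measurable; first exact: countableP.
by move=> k; rewrite /F; case: ifP => _ //; exact: measurable_cube.
Qed.

End measurability.

(** * Measure of cubes and Euclidean balls *)

Section volume.
Context {R : realType}.

(* By induction on [n], integrating the covering inequality in the last variable:
   this absorbs the factor [B k n - A k n] into the coefficient [c k]. *)
Lemma volume_le_cover (n : nat) (C : R) (c : nat -> R)
    (A B : nat -> nat -> R) (a b : nat -> R) :
  0 <= C -> (forall k, 0 <= c k) -> (forall i, a i < b i) ->
  (forall x : nat -> R, (forall i, a i < x i <= b i) ->
    (C%:E <= \sum_(k <oo)
      (c k * \prod_(i < n) \1_(`]A k i, B k i]%classic) (x i))%:E)%E) ->
  ((C * \prod_(i < n) (b i - a i))%:E <=
    \sum_(k <oo) (c k * \prod_(i < n) Num.max 0 (B k i - A k i))%:E)%E.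
Proof.
elim: n C c => [|n IH] C c C0 c0 ab cov.
  have := cov b; rewrite big_ord0 mulr1 => /(_ _)/le_trans; apply.
    by move=> i; rewrite ab lexx.
  rewrite le_eqVlt; apply/orP; left; apply/eqP; apply: eq_eseriesr => k _.
  by rewrite !big_ord0.
rewrite big_ord_recr/= [_ * (b n - a n)]mulrC mulrA.
have ->: (\sum_(k <oo) (c k * \prod_(i < n.+1) Num.max 0 (B k i - A k i))%:E =
  \sum_(k <oo) (c k * Num.max 0 (B k n - A k n) *
    \prod_(i < n) Num.max 0 (B k i - A k i))%:E)%E.
  apply: eq_eseriesr => k _; rewrite big_ord_recr/=; congr EFin.
  by rewrite -!mulrA; congr (_ * _); rewrite mulrC.
apply: IH => //.
- by rewrite mulr_ge0// subr_ge0 ltW.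
- by move=> k; rewrite mulr_ge0// le_max lexx.
move=> x xab.
pose e k := c k * \prod_(i < n) \1_(`]A k i, B k i]%classic) (x i).
have e0 k : 0 <= e k.
  by rewrite mulr_ge0// prodr_ge0// => i _; rewrite indicE.
have cov' t : a n < t <= b n ->
    (C%:E <= \sum_(k <oo) (e k * \1_(`]A k n, B k n]%classic) t)%:E)%E.
  move=> tab; pose x' i := if i == n then t else x i.
  have := cov x'; rewrite /x' => /(_ _)/le_trans; apply.
    by move=> i; case: eqP => [->|_].
  rewrite le_eqVlt; apply/orP; left; apply/eqP; apply: eq_eseriesr => k _.
  rewrite big_ord_recr/= eqxx mulrA; congr (_ * _)%:E; congr (_ * _).
  by apply: eq_bigr => i _; rewrite ltn_eqF.
pose D := `]a n, b n]%classic : set R.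
have mD : measurable D by exact: measurable_itv.
have -> : (C * (b n - a n))%:E =
    (\int[lebesgue_measure]_(t in D) (C%:E))%E.
  have DE : lebesgue_measure D = (b n - a n)%:E.
    by rewrite /D lebesgue_measure_itv/= lte_fin ab EFinB.
  by rewrite integral_cst// EFinM; congr (_ * _)%E; rewrite -DE.
apply: (@le_trans _ _ (\int[lebesgue_measure]_(t in D)
    \sum_(k <oo) (e k * \1_(`]A k n, B k n]%classic) t)%:E)%E).
  apply: le_integral_nonmeasurable => t; first by rewrite lee_fin.
  by rewrite /D/= in_itv/=; exact: cov'.
have mJ k : measurable (`]A k n, B k n]%classic : set R) by [].
have mI k : measurable_fun D (EFin \o \1_(`]A k n, B k n]%classic)).
  exact/measurable_EFinP/measurable_indic.
have eI0 k t : (0 <= (e k * \1_(`]A k n, B k n]%classic) t)%:E)%E.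
  by rewrite lee_fin mulr_ge0// indicE.
rewrite integral_nneseries//; last first.
  by move=> k; apply/measurable_EFinP/measurable_funM => //;
    exact/measurable_EFinP/mI.
apply: lee_nneseries => [k _ _|k _].
  by apply: integral_ge0 => t _; exact: eI0.
under eq_integral do rewrite EFinM.
rewrite ge0_integralZl//; [|exact: mI|by rewrite lee_fin].
rewrite integral_indic//=.
apply: (@le_trans _ _ ((e k)%:E *
    lebesgue_measure (`]A k n, B k n]%classic : set R))%E).
  apply: lee_wpmul2l; first by rewrite lee_fin.
  by apply: le_measure; rewrite ?inE//; exact: measurableI.
rewrite lebesgue_measure_itv/= lte_fin /e.
case: ltP => AB; rewrite -?EFinB -?EFinM lee_fin.
  by rewrite max_r ?subr_ge0 ?(ltW AB)// mulrAC.
by rewrite max_l ?subr_le0// !(mulr0, mul0r).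
Qed.

(** Covering the box means that the indicators of the covering boxes sum to at least 1 on it: this
    is the hypothesis of [volume_le_cover] with [C = 1], boxes outside [P] getting weight 0. *)
Lemma box_volume_le_outer d (a b : 'rV[R]_d) :
  (forall i, a ord0 i < b ord0 i) ->
  ((\prod_(i < d) (b ord0 i - a ord0 i))%:E <= lebesgue_outer (box a b))%E.
Proof.
move=> ab; apply: le_ereal_inf_tmp => _ [P [u [v [cov ->]]]].
(* [volume_le_cover] indexes coordinates by [nat]. Past [d] the lower corner is extended by 0 and
   the upper one by 1, which keeps the sides nondegenerate. *)
pose ext z (w : 'rV[R]_d) (i : nat) : R :=
  if insub i is Some j then w ord0 j else z.
have extE z w (i : 'I_d) : ext z w i = w ord0 i by rewrite /ext valK.
have -> : \prod_(i < d) (b ord0 i - a ord0 i) =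
    1 * \prod_(i < d) (ext 1 b i - ext 0 a i).
  by rewrite mul1r; apply: eq_bigr => i _; rewrite !extE.
apply: le_trans (@volume_le_cover d 1 (fun k => (P k)%:R)
  (fun k => ext 0 (u k)) (fun k => ext 0 (v k)) (ext 0 a) (ext 1 b)
  ler01 _ _ _) _ => //.
- by move=> i; rewrite /ext; case: insub.
- move=> x xab.
  have : box a b (\row_i x i).
    by move=> i; rewrite mxE; have := xab i; rewrite !extE.
  move=> /cov[k /= Pk xk].
  apply: (@le_trans _ _ ((P k)%:R * \prod_(i < d)
    \1_(`]ext 0 (u k) i, ext 0 (v k) i]%classic) (x i))%:E).
    rewrite Pk mul1r lee_fin big1// => i _; rewrite indicE mem_set//=.
    by have := xk i; rewrite mxE !extE in_itv.
  rewrite (nneseriesD1 (n := k))//.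
    rewrite leeDl//; apply: nneseries_ge0 => j _ _.
    by rewrite lee_fin mulr_ge0// prodr_ge0// => i _; rewrite indicE.
  by move=> j _; rewrite lee_fin mulr_ge0// prodr_ge0// => i _; rewrite indicE.
- rewrite [leRHS]eseries_mkcond; apply: lee_nneseries => [k _|k _].
    by rewrite lee_fin mulr_ge0// prodr_ge0// => i _; rewrite le_max lexx.
  case: ifPn => Pk; last by rewrite mul0r.
  rewrite mul1r lee_fin /box_volume.
  by under eq_bigr => i _ do rewrite !extE.
Qed.

Context {d : nat}.
Local Notation T := (Rd R d).
Local Notation mu := (@lebesgue_Rd R d).

Lemma cube_measure_le (y : 'rV[R]_d) (r : R) : 0 < r ->
  (mu (cube y r) <= ((2 * r) ^+ d)%:E)%E.
Proof.
move=> r0; apply: ereal_inf_lbound.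
exists (pred1 0%N), (fun=> y - const_mx r), (fun=> y + const_mx r); split.
  move=> x xy; exists 0%N => //= i; rewrite !mxE.
  by have := xy i; rewrite ltr_norml; lra.
rewrite (nneseriesD1 (n := 0%N))//=; last by move=> *; exact: box_volume_ge0.
rewrite eseries0 ?adde0; last by move=> k _ /=; case: k.
rewrite /box_volume; congr EFin.
under eq_bigr do rewrite !mxE.
rewrite (eq_bigr (fun=> 2 * r)) ?prodr_const ?card_ord// => i _.
by rewrite (_ : _ - _ = 2 * r) ?max_r; lra.
Qed.

Lemma eball_cube (y : 'rV[R]_d) (r : R) : eball y r `<=` cube y r.
Proof.
move=> x; rewrite /eball/= => xy i; apply: le_lt_trans xy.
rewrite -sqrtr_sqr ler_wsqrtr// (bigD1 i)//= lerDl sumr_ge0// => j _.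
by rewrite sqr_ge0.
Qed.

Lemma eball_measure_le (y : 'rV[R]_d) (r : R) : 0 < r ->
  (mu (eball y r) <= ((2 * r) ^+ d)%:E)%E.
Proof.
move=> r0; apply: le_trans (cube_measure_le y r0).
by apply: le_lebesgue_outer; exact: eball_cube.
Qed.

(** The squared distance is less than d r^2, which is at most (d r)^2; the factor [d] in place of
    its square root only affects constants. *)
Lemma cube_eball (y : 'rV[R]_d) (r : R) : (0 < d)%N ->
  cube y r `<=` eball y (d%:R * r).
Proof.
move=> d0 x xy; rewrite /eball/=.
have r0 : 0 < r.
  by apply: le_lt_trans (xy (Ordinal d0)).
have dr : 0 <= d%:R * r by rewrite mulr_ge0// ltW.
rewrite -(ger0_norm dr) -sqrtr_sqr ltr_sqrt ?exprn_gt0 ?mulr_gt0 ?ltr0n//.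
apply: (@lt_le_trans _ _ (\sum_(i < d) r ^+ 2)).
  apply: ltr_sum; first by apply/hasP; exists (Ordinal d0) => //; rewrite mem_index_enum.
  move=> i _; rewrite -real_normK ?num_real// ltr_pXn2r ?nnegrE ?(ltW r0)//.
rewrite sumr_const card_ord -[leLHS]mulr_natl exprMn ler_wpM2r ?sqr_ge0//.
by rewrite expr2 ler_peMl// ler1n.
Qed.

Lemma eball_measure_ge (y : 'rV[R]_d) (r : R) : (0 < d)%N -> 0 < r ->
  (((d%:R^-1 * r) ^+ d)%:E <= mu (eball y r))%E.
Proof.
move=> d0 r0.
have dn0 : d%:R != 0 :> R by rewrite pnatr_eq0 -lt0n.
have rd0 : 0 < d%:R^-1 * r by rewrite mulr_gt0// invr_gt0 ltr0n.
pose s := d%:R^-1 * r.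
(* Half-sides [s / 2] put the half-open box, including its closed faces, inside the open cube of
   radius [s], and make its volume exactly s^d. *)
pose a : 'rV[R]_d := y - const_mx (s / 2).
pose b : 'rV[R]_d := y + const_mx (s / 2).
have ab i : a ord0 i < b ord0 i by rewrite !mxE; rewrite /s; lra.
have : box a b `<=` eball y r.
  apply: subset_trans (_ : cube y s `<=` _).
    by move=> x xab i; have := xab i; rewrite !mxE ltr_norml /s; lra.
  have -> : r = d%:R * s by rewrite /s mulVKf.
  exact: cube_eball.
move=> /le_lebesgue_outer; apply: le_trans.
apply: le_trans (box_volume_le_outer ab).
rewrite lee_fin.
under eq_bigr do rewrite !mxE.
rewrite (eq_bigr (fun=> s)) ?prodr_const ?card_ord// => i _; lra.
Qed.

End volume.

(** * The maximal function: weak type (1, 1) *)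

Section maximal.
Context {R : realType} {d : nat}.
Local Notation T := (Rd R d).
Local Notation mu := (@lebesgue_Rd R d).
Implicit Types (h : T -> R) (x y : 'rV[R]_d).

(* Vitali's covering argument, greedily discarding every cube that meets the
   largest one: such a cube lies in the threefold dilation. *)
Lemma vitali_measure h (I : choiceType) (c : I -> 'rV[R]_d) (r : I -> R) (a : R)
    (s : seq I) (U := fun s : seq I => \bigcup_(i in [set` s]) cube (c i) (r i)) :
  measurable_fun [set: T] h -> (forall x, 0 <= h x) -> 0 < a ->
  (forall i, i \in s -> 0 < r i /\
    ((a * r i ^+ d)%:E <= \int[mu]_(x in cube (c i) (r i)) (h x)%:E)%E) ->
  (mu (U s) <= (6 ^+ d / a)%:E * \int[mu]_(x in U s) (h x)%:E)%E.
Proof.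
move=> mh h0 a0.
have mEh D : measurable_fun D (EFin \o h).
  by apply/measurable_EFinP; exact: measurable_funS mh.
have mU t : measurable (U t : set T).
  by rewrite /U bigcup_seq; apply: bigsetU_measurable => i _; exact: measurable_cube.
have I0 D : (0 <= \int[mu]_(x in D) (h x)%:E)%E.
  by apply: integral_ge0 => x _; rewrite lee_fin.
have [n] := ubnP (size s); elim: n s => // n IH s; rewrite ltnS => sn hs.
have [->|s0] := eqVneq s [::].
  rewrite (_ : U [::] = set0); last by rewrite /U; apply/seteqP; split=> x // [].
  by rewrite measure0 integral_set0 mule0.
have [k ks kmax] : exists2 k, k \in s & {in s, forall i, r i <= r k}.
  elim: s s0 {IH sn hs} => // i [_ _|j s /(_ isT)[k ks kmax] _].
    by exists i; rewrite ?mem_seq1// => j; rewrite mem_seq1 => /eqP ->.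
  have [rik|rki] := leP (r i) (r k).
    exists k; first by rewrite inE ks orbT.
    by move=> l; rewrite inE => /predU1P[->//|]; exact: kmax.
  exists i; first by rewrite inE eqxx.
  move=> l; rewrite inE => /predU1P[->//|/kmax/le_trans]; apply; exact: ltW.
have [rk0 rkh] := hs _ ks.
pose s' := [seq i <- s | disj_set (cube (c i) (r i)) (cube (c k) (r k))].
have ss' : {subset s' <= s} by move=> i; rewrite mem_filter => /andP[].
have kk : cube (c k) (r k) (c k) by move=> i; rewrite subrr normr0.
have ks' : k \notin s'.
  rewrite mem_filter ks andbT; apply/negP => /disj_setPS/(_ (c k)); exact.
have ltss' : (size s' < size s)%N.
  rewrite size_filter -[ltnRHS](count_predC (fun i =>
    disj_set (cube (c i) (r i)) (cube (c k) (r k)))) -addn1 leq_add2l.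
  rewrite -has_count; apply/hasP; exists k => //=.
  by move: ks'; rewrite mem_filter ks andbT.
have disj : disj_set (cube (c k) (r k)) (U s').
  apply/disj_setPS => x [xk [i /= is' xi]].
  move: is'; rewrite mem_filter => /andP[/disj_setPS + _].
  by move=> /(_ x); apply.
have cov : U s `<=` cube (c k) (3 * r k) `|` U s'.
  move=> x [i /= si xi].
  have [di|/negP ndi] :=
    boolP (disj_set (cube (c i) (r i)) (cube (c k) (r k))).
    by right; exists i => //=; rewrite mem_filter di si.
  left; have [z [zi zk]] : cube (c i) (r i) `&` cube (c k) (r k) !=set0.
    by apply/set0P/negP => /eqP e; apply: ndi; rewrite /disj_set e.
  move=> j; have := xi j; have := zi j; have := zk j; have := kmax _ si.
  rewrite !ltr_norml => h1 /andP[h2 h3] /andP[h4 h5] /andP[h6 h7].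
  by apply/andP; split; lra.
apply: (le_trans (le_lebesgue_outer cov)).
apply: (le_trans (outer_measureU2 _ _ _)).
apply: (@le_trans _ _ ((6 ^+ d / a)%:E * \int[mu]_(x in cube (c k) (r k)) (h x)%:E +
   (6 ^+ d / a)%:E * \int[mu]_(x in U s') (h x)%:E)%E).
  apply: leeD; last first.
    apply: IH; first exact: leq_trans sn.
    by move=> i /ss'; exact: hs.
  (* The threefold dilation has volume at most (6 r_k)^d, which is 6^d / a times the lower bound a
     r_k^d for the integral over the largest cube. *)
  apply: (le_trans (cube_measure_le _ _)); first by rewrite mulr_gt0.
  apply: (@le_trans _ _ ((6 ^+ d / a)%:E * (a * r k ^+ d)%:E)%E).
    rewrite -EFinM lee_fin [leRHS]mulrA divfK ?gt_eqF// -exprMn.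
    by rewrite (_ : 2 * (3 * r k) = 6 * r k)//; lra.
  by apply: lee_wpmul2l => //; rewrite lee_fin divr_ge0 ?exprn_ge0 ?ltW.
rewrite -ge0_muleDr// -ge0_integral_setU//=;
  [|exact: measurable_cube|by move=> x _; rewrite lee_fin].
apply: lee_wpmul2l; first by rewrite lee_fin divr_ge0 ?exprn_ge0 ?ltW.
apply: ge0_subset_integral.
- by apply: measurableU; [exact: measurable_cube|exact: mU].
- exact: mU.
- exact: mEh.
- by move=> x _; rewrite lee_fin.
- move=> x [xk|[i /= /ss' si xi]]; first by exists k.
  by exists i.
Qed.

(** [pickle] enumerates the pairs of a rational centre and a rational radius. A number that encodes
    no pair gets radius 0, which [maximal] excludes by [0 < qradius n]. *)
Definition qcenter (n : nat) : 'rV[R]_d :=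
  map_mx ratr (odflt (0, 0) (unpickle n : option ('rV[rat]_d * rat))).1.
Definition qradius (n : nat) : R :=
  ratr (odflt (0, 0) (unpickle n : option ('rV[rat]_d * rat))).2.
Definition qcube n : set T := cube (qcenter n) (qradius n).

(* Uncentered maximal function over cubes with rational data: a supremum over
   [nat], hence measurable, which dominates all the averages over balls. *)
Definition maximal h (x : T) : \bar R :=
  ereal_sup [set ((qradius n ^- d)%:E * \int[mu]_(y in qcube n) (h y)%:E)%E |
    n in [set n | 0 < qradius n /\ qcube n x]].

(** Take a rational centre within [r] of [x] and a rational radius between 2r and 4r: points within
    [r] of [x] are within 2r of the centre. *)
Lemma qcube_approx (x : T) (r : R) : 0 < r -> exists n,
  [/\ 0 < qradius n, qradius n <= 4 * r, qcube n x & cube x r `<=` qcube n].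
Proof.
move=> r0; have [v vx] := rational_approx x r0.
have /rat_in_itvoo[q] : 2 * r < 4 * r by lra.
rewrite in_itv/= => /andP[q2 q4].
exists (pickle (v, q)); rewrite /qcube /qradius /qcenter pickleK/=.
split; [lra|lra| |].
  by move=> i; rewrite distrC; apply: (lt_trans (vx i)); lra.
move=> z zx i; have := zx i; have := vx i.
by rewrite !ltr_norml => /andP[h1 h2] /andP[h3 h4]; apply/andP; split; lra.
Qed.

Lemma maximal_ge0 h x : (forall x, 0 <= h x) -> (0 <= maximal h x)%E.
Proof.
move=> h0; have [n [n0 _ nx _]] := qcube_approx x ltr01.
apply: le_trans (ereal_sup_ubound _); last by exists n.
apply: mule_ge0; first by rewrite lee_fin invr_ge0 exprn_ge0// ltW.
by apply: integral_ge0 => y _; rewrite lee_fin.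
Qed.

Lemma average_le_maximal h (x : T) (r : R) :
  measurable_fun [set: T] h -> (forall x, 0 <= h x) -> 0 < r ->
  (\int[mu]_(y in eball x r) (h y)%:E <= ((4 * r) ^+ d)%:E * maximal h x)%E.
Proof.
move=> mh h0 r0; have [n [n0 nr nx xn]] := qcube_approx x r0.
have I0 D : (0 <= \int[mu]_(x in D) (h x)%:E)%E.
  by apply: integral_ge0 => y _; rewrite lee_fin.
apply: (@le_trans _ _ (((4 * r) ^+ d)%:E *
    ((qradius n ^- d)%:E * \int[mu]_(y in qcube n) (h y)%:E))%E).
  apply: (@le_trans _ _ (\int[mu]_(y in qcube n) (h y)%:E)%E).
    apply: ge0_subset_integral.
    - exact: measurable_eball.
    - exact: measurable_cube.
    - by apply/measurable_EFinP; exact: measurable_funS mh.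
    - by move=> y _; rewrite lee_fin.
    - by apply: subset_trans xn; exact: eball_cube.
  rewrite muleA -EFinM -[leLHS]mul1e; apply: lee_wpmul2r => //.
  by rewrite lee_fin ler_pdivlMr ?exprn_gt0// mul1r lerXn2r// nnegrE ltW// mulr_gt0.
apply: lee_wpmul2l; first by rewrite lee_fin exprn_ge0// mulr_ge0// ltW.
by apply: ereal_sup_ubound; exists n.
Qed.

(** As the maximal function is uncentred, a cube with average above [a] lies entirely in the
    superlevel set. This gives both measurability and the family of cubes for the covering
    argument. *)
Lemma maximal_superlevel h (a : R) :
  [set x | (a%:E < maximal h x)%E] =
  \bigcup_(n in [set n | 0 < qradius n /\
    ((a * qradius n ^+ d)%:E < \int[mu]_(y in qcube n) (h y)%:E)%E]) qcube n.
Proof.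
have E n : 0 < qradius n ->
    (a%:E < (qradius n ^- d)%:E * \int[mu]_(y in qcube n) (h y)%:E)%E =
    ((a * qradius n ^+ d)%:E < \int[mu]_(y in qcube n) (h y)%:E)%E.
  move=> n0; have rn : 0 < qradius n ^+ d by rewrite exprn_gt0.
  by rewrite muleC lte_pdivlMr// EFinM.
apply/seteqP; split=> x /=.
  move=> /ereal_sup_gt[_ [n [n0 nx] <-]] an; exists n => //=.
  by rewrite -E.
move=> [n /= [n0 na] nx]; move: na; rewrite -E// => /lt_le_trans; apply.
by apply: ereal_sup_ubound; exists n.
Qed.

Lemma measurable_maximal h : measurable_fun [set: T] (maximal h).
Proof.
apply: (measurability _ (ErealGenOInfty.measurableE R)).
move=> /= _ [_ [a ->]] <-; rewrite setTI preimage_itvoy.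
rewrite [X in measurable X](_ : _ = [set x | (a%:E < maximal h x)%E])//.
rewrite maximal_superlevel; apply: bigcup_measurable => n _.
exact: measurable_cube.
Qed.

(** [vitali_measure] bounds every finite subunion of the cubes forming the superlevel set, with a
    constant independent of the subfamily; continuity of the measure from below gives the whole
    union. *)
Lemma maximal_weak h (a : R) :
  measurable_fun [set: T] h -> (forall x, 0 <= h x) -> 0 < a ->
  (mu [set x | (a%:E < maximal h x)%E] <=
    (6 ^+ d / a)%:E * \int[mu]_x (h x)%:E)%E.
Proof.
move=> mh h0 a0; rewrite maximal_superlevel.
set N := [set n | _]; rewrite bigcup_mkcond.
set F := fun n => if n \in N then qcube n else set0.
have mF n : measurable (F n).
  by rewrite /F; case: ifP => // _; exact: measurable_cube.
have mUF n : measurable (\big[setU/set0]_(i < n) F i).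
  by apply: bigsetU_measurable.
have -> : \bigcup_n F n = \bigcup_n \big[setU/set0]_(i < n) F i.
  apply/seteqP; split=> [x [n _ Fx]|x [n _]].
    by exists n.+1 => //; rewrite big_ord_recr/=; right.
  by rewrite -bigcup_mkord => -[i _ Fx]; exists i.
have := nondecreasing_cvg_mu (mu := mu) mUF.
move=> /(_ (bigcupT_measurable _ mUF)) H.
have {}H := H (fun m n mn => introT (subsetPset _ _) (subset_bigsetU mn)).
rewrite -(cvg_lim _ H)//; apply: lime_le; first by apply/cvg_ex; eexists; exact: H.
apply: nearW => n /=.
pose s := [seq i <- iota 0 n | i \in N].
have -> : \big[setU/set0]_(i < n) F i =
    \bigcup_(i in [set` s]) cube (qcenter i) (qradius i).
  rewrite -(big_mkord xpredT F) /index_iota subn0 -bigcup_seq.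
  apply/seteqP; split => x [i /= si].
    rewrite /F; case: ifPn => // iN xi; exists i => //=.
    by rewrite mem_filter iN.
  move: si; rewrite mem_filter => /andP[iN si] xi; exists i => //=.
  by rewrite /F iN.
apply: le_trans (vitali_measure mh h0 a0 _) _.
  by move=> i; rewrite mem_filter => /andP[/set_mem[? /ltW]].
apply: lee_wpmul2l; first by rewrite lee_fin divr_ge0 ?exprn_ge0 ?ltW.
apply: ge0_subset_integral => //.
- by rewrite bigcup_seq; apply: bigsetU_measurable => i _; exact: measurable_cube.
- exact/measurable_EFinP.
- by move=> x _; rewrite lee_fin.
Qed.

End maximal.

(** * The maximal function: strong type (q, q) *)

Section dyadic_sums.
Context {R : realType}.

Lemma gt1_powR (a s : R) : 1 < a -> 0 < s -> 1 < a `^ s.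
Proof.
move=> a1 s0; have := @gt0_ltr_powR R s s0 1 a.
by rewrite powR1; apply; rewrite ?nnegrE// (le_trans ler01)// ltW.
Qed.

Lemma nneseries_ge_term (u : nat -> \bar R) (k : nat) :
  (forall n, (0 <= u n)%E) -> (u k <= \sum_(n <oo) u n)%E.
Proof.
move=> u0; rewrite (nneseriesD1 (n := k))// leeDl//.
by apply: nneseries_ge0 => *; exact: u0.
Qed.

Lemma exists_dyadic_gt (a B : R) : 0 < a -> exists n : nat, B < a * 2 ^+ n.
Proof.
move=> a0; have [B0|B0] := leP B 0.
  by exists 0%N; rewrite expr0 mulr1; exact: le_lt_trans a0.
have /archi_boundP : 0 <= B / a by rewrite divr_ge0// ltW.
set n := Num.bound _ => Bn; exists n.
rewrite -ltr_pdivrMl// mulrC; apply: (lt_trans Bn).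
by rewrite -natrX ltr_nat ltn_expl.
Qed.

(** A discrete layer-cake inequality: if a 2^m < v <= a 2^(m+1), the term of index m alone dominates
    v^q; the term a^q takes care of v <= a, and for infinite v the terms are unbounded. *)
Lemma powR_le_dyadic_sum (q a : R) (v : \bar R) : 1 < q -> 0 < a -> (0 <= v)%E ->
  (v `^ q <= (a `^ q)%:E + \sum_(n <oo)
    ((a * 2 ^+ n.+1) `^ q * ((a * 2 ^+ n)%:E < v)%E%:R)%:E)%E.
Proof.
move=> q1 a0; have q0 : 0 < q by exact: lt_trans q1.
move=> v0; pose u n := ((a * 2 ^+ n.+1) `^ q * ((a * 2 ^+ n)%:E < v)%E%:R)%:E.
rewrite (_ : (\sum_(n <oo) _)%E = (\sum_(n <oo) u n)%E)//.
have u0 n : (0 <= u n)%E by rewrite lee_fin mulr_ge0// powR_ge0.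
have S0 : (0 <= \sum_(n <oo) u n)%E by apply: nneseries_ge0 => *; exact: u0.
have uv n : ((a * 2 ^+ n)%:E < v)%E -> u n = ((a * 2 ^+ n.+1) `^ q)%:E.
  by move=> h; rewrite /u h mulr1.
case: v v0 u u0 S0 uv => [v| |//] v0 u u0 S0 uv; last first.
  rewrite (_ : (\sum_(n <oo) u n)%E = +oo%E) ?addey ?leey//.
  apply/eqyP => A A0; have [n nA] := exists_dyadic_gt (A `^ q^-1) a0.
  apply: le_trans (nneseries_ge_term n u0).
  rewrite uv ?ltry// lee_fin.
  have -> : A = (A `^ q^-1) `^ q by rewrite -powRrM mulVf ?gt_eqF// powRr1// ltW.
  apply: ge0_ler_powR; rewrite ?nnegrE ?powR_ge0 ?ltW//.
    by rewrite mulr_gt0// exprn_gt0.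
  rewrite exprS mulrCA; apply: (lt_le_trans nA).
  by rewrite ler_peMl ?ler1n// mulr_ge0 ?exprn_ge0 ?ltW.
move: v0; rewrite lee_fin => v0; have [va|av] := leP v a.
  rewrite -[leLHS]adde0; apply: leeD => //; rewrite poweR_EFin lee_fin.
  by apply: ge0_ler_powR; rewrite ?nnegrE// ltW.
have [n nv] := exists_dyadic_gt v a0.
have exP : exists n, v <= a * 2 ^+ n by exists n; exact: ltW.
case: (ex_minnP exP) => -[|m]; first by rewrite expr0 mulr1 leNgt av.
move=> vm mmin; have mv : a * 2 ^+ m < v.
  by rewrite ltNge; apply/negP => /mmin; rewrite ltnn.
apply: (@le_trans _ _ (u m)); last first.
  rewrite -[leLHS]add0e; apply: leeD; first by rewrite lee_fin powR_ge0.
  exact: nneseries_ge_term.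
rewrite uv ?lte_fin// poweR_EFin lee_fin.
by apply: ge0_ler_powR; rewrite ?nnegrE ?(ltW q0)//; exact: le_trans vm.
Qed.

(** The nonzero terms form a geometric progression of ratio 2^s > 1, whose sum is at most 2^s / (2^s
    - 1) times its last term, itself at most u^s. *)
Lemma dyadic_sum_le_powR (s b u : R) : 0 < s -> 0 < b -> 0 <= u ->
  (\sum_(n <oo) ((b * 2 ^+ n) `^ s * (b * 2 ^+ n < u)%R%:R)%:E <=
    (2 `^ s / (2 `^ s - 1) * u `^ s)%:E)%E.
Proof.
move=> s0 b0 u0; set w := 2 `^ s; set K := w / (w - 1).
have w1 : 1 < w by rewrite gt1_powR// ltr1n.
have wD : w - 1 != 0 by rewrite subr_eq0 gt_eqF.
have K0 : 0 <= K by rewrite divr_ge0 ?subr_ge0 ?ltW// (lt_trans _ w1).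
have xS m : (b * 2 ^+ m.+1) `^ s = w * (b * 2 ^+ m) `^ s.
  have -> : b * 2 ^+ m.+1 = 2 * (b * 2 ^+ m) by rewrite exprS mulrCA.
  by rewrite powRM// mulr_ge0 ?exprn_ge0// ltW.
have geo m : \sum_(0 <= n < m.+1) (b * 2 ^+ n) `^ s <= K * (b * 2 ^+ m) `^ s.
  elim: m => [|m IH].
    rewrite big_nat1 ler_peMl ?powR_ge0// /K ler_pdivlMr ?subr_gt0// mul1r.
    by rewrite lerBlDr lerDl.
  rewrite big_nat_recr//= (le_trans (lerD IH (lexx _)))// xS.
  rewrite -mulrDl mulrA ler_wpM2r ?powR_ge0//.
  by rewrite le_eqVlt; apply/orP; left; apply/eqP; rewrite /K; field.
apply: lime_le.
  by apply: is_cvg_nneseries => n _ _; rewrite lee_fin mulr_ge0// powR_ge0.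
apply: nearW => m; rewrite sumEFin lee_fin.
elim: m => [|m IH]; first by rewrite big_geq// mulr_ge0// powR_ge0.
have [mu|um] := ltP (b * 2 ^+ m) u; last first.
  by rewrite big_nat_recr//= ltNge um mulr0 addr0.
apply: (@le_trans _ _ (\sum_(0 <= n < m.+1) (b * 2 ^+ n) `^ s)).
  by apply: ler_sum => n _; rewrite ler_piMr ?powR_ge0// lern1 leq_b1.
apply: (le_trans (geo m)); rewrite ler_wpM2l//.
apply: ge0_ler_powR; rewrite ?nnegrE ?(ltW s0)// ?(ltW mu)//.
by rewrite mulr_ge0 ?exprn_ge0// ltW.
Qed.

End dyadic_sums.

Section strong_type.
Context {R : realType} {d : nat}.
Local Notation T := (Rd R d).
Local Notation mu := (@lebesgue_Rd R d).
Implicit Types (h : T -> R).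

Lemma indic_boolE (P : pred T) x : \1_[set y | P y] x = (P x)%:R :> R.
Proof.
rewrite indicE; have -> // : (x \in [set y | P y]) = P x.
by apply/idP/idP => [/set_mem|/mem_set].
Qed.

(** The truncation of Marcinkiewicz interpolation: at each level, the weak type is applied to this
    part of [h]. *)
Definition above (c : R) h : T -> R := fun x => h x * \1_[set x | c < h x] x.

Lemma above_ge0 c h : (forall x, 0 <= h x) -> forall x, 0 <= above c h x.
Proof. by move=> h0 x; rewrite /above mulr_ge0// indicE. Qed.

Lemma measurable_above c h : measurable_fun [set: T] h ->
  measurable_fun [set: T] (above c h).
Proof.
move=> mh; apply: (measurable_funM mh); apply: measurable_indic.
have := mh measurableT _ (measurable_itv `]c, +oo[).
by rewrite setTI preimage_itvoy.
Qed.

Lemma integral_le_above (D : set T) h (c : R) :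
  measurable D -> measurable_fun [set: T] h -> (forall x, 0 <= h x) -> 0 <= c ->
  (\int[mu]_(x in D) (h x)%:E <=
    c%:E * mu D + \int[mu]_(x in D) (above c h x)%:E)%E.
Proof.
move=> mD mh h0 c0.
rewrite -(integral_cst _ mD) -(ge0_integralD _ mD); last 4 first.
- by move=> x _; rewrite lee_fin.
- exact: measurable_cst.
- by move=> x _; rewrite lee_fin above_ge0.
- exact/measurable_EFinP/measurable_funTS/measurable_above.
apply: le_integral_nonmeasurable => x _; first by rewrite lee_fin.
rewrite -EFinD lee_fin /above indic_boolE.
by case: (ltP c (h x)) => hc; rewrite ?mulr1 ?lerDr// mulr0 addr0.
Qed.

(** Values of [h] up to c = 2^-(d+1) a contribute at most c (2r)^d = (a / 2) r^d to the integral
    over a cube of radius r. If that integral exceeds a r^d, the part above [c] contributes more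
    than (a / 2) r^d, and the weak type applies to it at height a / 2. *)
Lemma maximal_weak_above h (a : R) :
  measurable_fun [set: T] h -> (forall x, 0 <= h x) -> 0 < a ->
  (mu [set x | (a%:E < maximal h x)%E] <=
    (2 * 6 ^+ d / a)%:E * \int[mu]_x (above (2 ^- d.+1 * a) h x)%:E)%E.
Proof.
move=> mh h0 a0; set c := 2 ^- d.+1 * a.
have c0 : 0 <= c by rewrite mulr_ge0 ?invr_ge0 ?exprn_ge0// ltW.
have a20 : 0 < a / 2 by rewrite divr_gt0.
have -> : 2 * 6 ^+ d / a = 6 ^+ d / (a / 2).
  by field; rewrite gt_eqF.
apply: le_trans (maximal_weak (measurable_above c mh) (above_ge0 c h0) a20).
apply: le_lebesgue_outer; rewrite !maximal_superlevel => x [n /= [n0 na] nx].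
exists n => //=; split=> //; rewrite ltNge; apply/negP => hn.
move: na; rewrite ltNge => /negP; apply.
have -> : a * @qradius R d n ^+ d =
    c * (2 * @qradius R d n) ^+ d + a / 2 * @qradius R d n ^+ d.
  move: (@qradius R d n) => t; rewrite /c exprMn exprS.
  have : (2 : R) ^+ d != 0 by rewrite expf_neq0.
  by move: (2 ^+ d) => z z0; field.
apply: le_trans (integral_le_above (measurable_cube _ _) mh h0 c0) _.
rewrite EFinD; apply: leeD => //; rewrite [leRHS]EFinM.
by apply: lee_wpmul2l; rewrite ?lee_fin//; exact: cube_measure_le.
Qed.

(** Rewrites the coefficient produced at level [z] as a power q - 1 of the truncation height
    [c * z], the form that [dyadic_sum_le_powR] can sum. *)
Lemma strong_type_coefficient (M q c z : R) : 0 < q -> 0 < c -> 0 < z ->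
  (2 * z) `^ q * (2 * M / z) =
  2 `^ q * (2 * M) * c `^ (- (q - 1)) * (c * z) `^ (q - 1).
Proof.
move=> q0 c0 z0; rewrite !powRM ?(ltW c0) ?(ltW z0)// powRN.
rewrite -(mulr_powRB1 (ltW z0) q0).
have : c `^ (q - 1) != 0 by rewrite gt_eqF// powR_gt0.
have : z != 0 by rewrite gt_eqF.
move: (c `^ _) (z `^ _) (2 `^ _) => u v w {}z0 u0; field.
by rewrite z0 u0.
Qed.

(** Marcinkiewicz interpolation over the dyadic levels a 2^n. The values of the maximal function up
    to [a] cost a^q times the measure of [D], which is finite, so this error vanishes as [a] tends
    to 0. *)
Lemma maximal_strong (q : R) : 1 < q -> exists2 C : R, 0 < C &
  forall h (D : set T), measurable_fun [set: T] h -> (forall x, 0 <= h x) ->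
    measurable D -> (mu D < +oo)%E ->
    (\int[mu]_(x in D) maximal h x `^ q <=
      C%:E * \int[mu]_x (h x `^ q)%:E)%E.
Proof.
move=> q1; pose s := q - 1; pose c : R := 2 ^- d.+1.
have q0 : 0 < q by exact: lt_trans q1.
have s0 : 0 < s by rewrite subr_gt0.
have c0 : 0 < c by rewrite invr_gt0 exprn_gt0.
have w1 : 1 < 2 `^ s by rewrite gt1_powR// ltr1n.
pose G := 2 `^ q * (2 * 6 ^+ d) * c `^ (- s).
have G0 : 0 < G by rewrite !mulr_gt0 ?powR_gt0 ?exprn_gt0.
pose K : R := 2 `^ s / (2 `^ s - 1).
have K0 : 0 < K by rewrite divr_gt0 ?subr_gt0// (lt_trans _ w1).
exists (G * K) => [|h D mh h0 mD Dfin]; first exact: mulr_gt0.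
have mhq : measurable_fun [set: T] (fun x => (h x `^ q)%:E).
  by apply/measurable_EFinP; exact: measurableT_comp (measurable_powR _) mh.
have key (a : R) : 0 < a -> (\int[mu]_(x in D) maximal h x `^ q <=
    (a `^ q)%:E * mu D + (G * K)%:E * \int[mu]_x (h x `^ q)%:E)%E.
  move=> a0; pose b := c * a; have b0 : 0 < b by rewrite mulr_gt0.
  pose E (n : nat) := [set x | ((a * 2 ^+ n)%:E < maximal h x)%E].
  have a2 n : 0 < a * 2 ^+ n by rewrite mulr_gt0 ?exprn_gt0.
  have mE n : measurable (E n).
    have := measurable_maximal h measurableT (emeasurable_itv `](a * 2 ^+ n)%:E, +oo[).
    by rewrite setTI preimage_itvoy.
  pose u n x := ((a * 2 ^+ n.+1) `^ q * \1_(E n) x)%:E.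
  have u0 n x : (0 <= u n x)%E by rewrite lee_fin mulr_ge0 ?powR_ge0 ?indicE.
  have mu_ n : measurable_fun D (u n).
    by apply/measurable_EFinP; apply: measurable_funM => //; exact: measurable_indic.
  apply: (@le_trans _ _ (\int[mu]_(x in D)
      ((a `^ q)%:E + \sum_(n <oo) u n x))%E).
    apply: le_integral_nonmeasurable => x _; first exact: poweR_ge0.
    apply: le_trans (powR_le_dyadic_sum q1 a0 (maximal_ge0 x h0)) _.
    apply: leeD => //; apply: lee_nneseries => n _ *.
      by rewrite lee_fin mulr_ge0 ?powR_ge0.
    by rewrite /u indic_boolE.
  rewrite (ge0_integralD _ mD); last 4 first.
  - by move=> x _; rewrite lee_fin powR_ge0.
  - exact: measurable_cst.
  - by move=> x _; apply: nneseries_ge0 => *; exact: u0.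
  - exact: ge0_emeasurable_sum.
  rewrite (integral_cst _ mD); apply: leeD => //.
  rewrite integral_nneseries//.
  pose f n x := ((G * (b * 2 ^+ n) `^ s) * above (b * 2 ^+ n) h x)%:E.
  have f0 n x : (0 <= f n x)%E.
    by rewrite lee_fin mulr_ge0 ?above_ge0// mulr_ge0 ?powR_ge0 ?ltW.
  have mf n : measurable_fun [set: T] (f n).
    apply/measurable_EFinP.
    exact: measurable_funM (measurable_cst _) (measurable_above _ mh).
  apply: (@le_trans _ _ (\sum_(n <oo) \int[mu]_x f n x)%E).
    apply: lee_nneseries => [n _ _|n _]; first exact: integral_ge0.
    rewrite /u; under eq_integral do rewrite EFinM.
    rewrite (ge0_integralZl _ mD); last 3 first.
    - exact/measurable_EFinP/measurable_indic.
    - by move=> x _; rewrite lee_fin indicE.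
    - by rewrite lee_fin powR_ge0.
    rewrite integral_indic//.
    apply: (@le_trans _ _ (((a * 2 ^+ n.+1) `^ q)%:E * mu (E n))%E).
      apply: lee_wpmul2l; first by rewrite lee_fin powR_ge0.
      by apply: le_measure; rewrite ?inE//; exact: measurableI.
    apply: (@le_trans _ _ (((a * 2 ^+ n.+1) `^ q)%:E *
       ((2 * 6 ^+ d / (a * 2 ^+ n))%:E *
        \int[mu]_x (above (2 ^- d.+1 * (a * 2 ^+ n)) h x)%:E))%E).
      apply: lee_wpmul2l; first by rewrite lee_fin powR_ge0.
      exact: maximal_weak_above.
    rewrite /f; under [leRHS]eq_integral do rewrite EFinM.
    rewrite (ge0_integralZl _ measurableT).
    - rewrite muleA -EFinM le_eqVlt; apply/orP; left; apply/eqP.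
      rewrite (mulrA (2 ^- d.+1)) -/c -/b; congr (_%:E * _)%E.
      rewrite -(mulrA c) exprS (mulrCA a) /G.
      exact: (strong_type_coefficient _ q0 c0 (a2 n)).
    - exact/measurable_EFinP/measurable_above.
    - by move=> x _; rewrite lee_fin above_ge0.
    - by rewrite lee_fin mulr_ge0 ?powR_ge0 ?ltW.
  (* With the sum back under the integral, only the levels with b 2^n < h x count at [x]: their
     powers q - 1 sum to a multiple of h(x)^(q - 1), and [above] supplies the missing factor
     h(x). *)
  rewrite -integral_nneseries//.
  rewrite -ge0_integralZl//; last 2 first.
  - by move=> x _; rewrite lee_fin powR_ge0.
  - by rewrite lee_fin ltW// mulr_gt0.
  apply: le_integral_nonmeasurable => x _.
    by apply: nneseries_ge0 => *; exact: f0.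
  have -> : (\sum_(n <oo) f n x = (G * h x)%:E *
      \sum_(n <oo) ((b * 2 ^+ n) `^ s * (b * 2 ^+ n < h x)%R%:R)%:E)%E.
    rewrite -nneseriesZl ?lee_fin ?mulr_ge0 ?(ltW G0)//; last first.
      by move=> n _; rewrite lee_fin mulr_ge0 ?powR_ge0.
    apply: eq_eseriesr => n _; rewrite -EFinM; congr EFin.
    by rewrite /above indic_boolE; ring.
  apply: (@le_trans _ _ ((G * h x)%:E * (K * h x `^ s)%:E)%E).
    apply: lee_wpmul2l; first by rewrite lee_fin mulr_ge0 ?(ltW G0).
    exact: dyadic_sum_le_powR.
  rewrite -!EFinM lee_fin le_eqVlt; apply/orP; left; apply/eqP.
  by rewrite -(mulr_powRB1 (h0 x) q0); ring.
apply/lee_addgt0Pr => e e0.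
have m0 : 0 <= fine (mu D) by rewrite fine_ge0.
(* The level [a] is chosen with a^q = z, so that a^q times the measure of [D] is at most [e]; adding
   1 avoids a zero denominator. *)
pose z := e / (fine (mu D) + 1).
have z0 : 0 < z by rewrite divr_gt0// ltr_wpDl.
apply: le_trans (key (z `^ q^-1) _) _; first exact: powR_gt0.
rewrite addeC; apply: leeD => //.
rewrite -powRrM mulVf ?gt_eqF// powRr1 ?(ltW z0)//.
rewrite -(@fineK _ (mu D)) ?ge0_fin_numE// -EFinM lee_fin /z mulrAC.
by rewrite ler_pdivrMr ?ltr_wpDl// ler_pM2l// lerDl.
Qed.

End strong_type.

(** * The local estimate *)

Section euclidean_balls.
Context {R : realType} {d : nat}.
Local Notation T := (Rd R d).
Local Notation mu := (@lebesgue_Rd R d).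
Implicit Types (x y z : 'rV[R]_d).

(** [eball y r x] is convertible to [edist x y < r]. *)
Definition edist x y : R :=
  Num.sqrt (\sum_(i < d) (x ord0 i - y ord0 i) ^+ 2).

Lemma cauchy_schwarz_sum (u v : 'I_d -> R) :
  (\sum_i u i * v i) ^+ 2 <= (\sum_i u i ^+ 2) * (\sum_i v i ^+ 2).
Proof.
set A := \sum_i u i ^+ 2; set B := \sum_i v i ^+ 2; set S := \sum_i u i * v i.
have A0 : 0 <= A by apply: sumr_ge0 => i _; exact: sqr_ge0.
have [A00|A_neq0] := eqVneq A 0.
  have u0 i : u i = 0.
    apply/eqP; rewrite -sqrf_eq0; apply/eqP.
    by apply: (psumr_eq0P _ A00) => // j _; exact: sqr_ge0.
  by rewrite A00 mul0r /S big1 ?expr0n// => i _; rewrite u0 mul0r.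
have A1 : 0 < A by rewrite lt_def A_neq0.
have : 0 <= \sum_i (A * v i - S * u i) ^+ 2.
  by apply: sumr_ge0 => i _; exact: sqr_ge0.
have -> : \sum_i (A * v i - S * u i) ^+ 2 = A * (A * B - S ^+ 2).
  rewrite (eq_bigr (fun i => A ^+ 2 * v i ^+ 2 + (- (2 * A * S) * (u i * v i)
    + S ^+ 2 * u i ^+ 2))); last by move=> i _; ring.
  rewrite !big_split/= -!mulr_sumr -/A -/B -/S; ring.
by rewrite pmulr_rge0// subr_ge0.
Qed.

Lemma edist_triangle x y z : edist x z <= edist x y + edist y z.
Proof.
rewrite /edist; set a := \sum_(i < d) (x ord0 i - y ord0 i) ^+ 2.
set b := \sum_(i < d) (y ord0 i - z ord0 i) ^+ 2.
have a0 : 0 <= a by apply: sumr_ge0 => i _; exact: sqr_ge0.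
have b0 : 0 <= b by apply: sumr_ge0 => i _; exact: sqr_ge0.
have s0 : 0 <= Num.sqrt a + Num.sqrt b by rewrite addr_ge0 ?sqrtr_ge0.
rewrite -[leRHS]ger0_norm// -sqrtr_sqr ler_wsqrtr//.
rewrite sqrrD !sqr_sqrtr// -sqrtrM//.
set S := \sum_(i < d) (x ord0 i - y ord0 i) * (y ord0 i - z ord0 i).
have -> : \sum_(i < d) (x ord0 i - z ord0 i) ^+ 2 = a + S *+ 2 + b.
  rewrite /a /b /S -sumrMnl -!big_split/=; apply: eq_bigr => i _; ring.
rewrite lerD2r lerD2l lerMn2r/=.
apply: (le_trans (ler_norm S)); rewrite -sqrtr_sqr ler_wsqrtr//.
exact: cauchy_schwarz_sum.
Qed.

Lemma edistC x y : edist x y = edist y x.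
Proof.
by rewrite /edist; congr Num.sqrt; apply: eq_bigr => i _; rewrite -sqrrN opprB.
Qed.

Lemma eball_sub x y (r s : R) : edist x y + r <= s -> eball x r `<=` eball y s.
Proof.
move=> xys z zx; apply: le_lt_trans (edist_triangle z x y) _.
by apply: lt_le_trans xys; rewrite addrC ltrD2l; exact: zx.
Qed.

Lemma eball_doubling x y (r : R) : edist x y < r -> eball x r `<=` eball y (2 * r).
Proof. by move=> xy; apply: eball_sub; rewrite mulr2n mulrDl mul1r lerD2r ltW. Qed.

Lemma eball_shrink x (t : R) :
  eball x t = \bigcup_n eball x (t - n.+1%:R^-1) :> set T.
Proof.
apply/seteqP; split=> [y yx|y [n _]]; last first.
  rewrite /eball/= => /lt_le_trans; apply.
  by rewrite gerBl invr_ge0.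
have e0 : 0 < t - edist y x by rewrite subr_gt0.
have [n _ /(_ n (leqnn n))/= hn] := near_infty_natSinv_lt (PosNum e0).
exists n => //; rewrite /eball/= ltrBrDl -ltrBrDr.
exact: hn.
Qed.

(** Lower semicontinuity: by monotone convergence an integral exceeding [a] over B(y, t) already
    exceeds it over a slightly smaller ball, which is contained in B(z, t) for all z near y. *)
Lemma measurable_integral_eball (g : T -> \bar R) (t : R) :
  (0 < d)%N -> measurable_fun [set: T] g -> (forall x, (0 <= g x)%E) ->
  measurable_fun [set: T] (fun y : T => (\int[mu]_(x in eball y t) g x)%E).
Proof.
move=> d0 mg g0; apply: (measurability _ (ErealGenOInfty.measurableE R)).
move=> /= _ [_ [a ->]] <-; rewrite setTI preimage_itvoy.
apply: open_cube_measurable => y /= ay.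
have [n an] : exists n : nat, (a%:E < \int[mu]_(x in eball y (t - n.+1%:R^-1)) g x)%E.
  apply: contrapT => /forallNP na; move: ay; rewrite ltNge => /negP; apply.
  have ndF : nondecreasing_seq (fun n => eball y (t - n.+1%:R^-1) : set T).
    move=> m n mn; apply/subsetPset => z; rewrite /eball/= => /lt_le_trans; apply.
    by rewrite lerD2l lerN2 lef_pV2 ?posrE// ler_nat.
  have mF n : measurable (eball y (t - n.+1%:R^-1) : set T).
    exact: measurable_eball.
  have mFg i : measurable_fun (eball y (t - i.+1%:R^-1) : set T) g.
    exact: measurable_funS mg.
  have := @ge0_nondecreasing_set_cvg_integral _ T R _ g mu ndF mF mFg
    (fun _ _ _ => g0 _).
  rewrite -eball_shrink => H; rewrite -(cvg_lim _ H)//.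
  apply: lime_le; first by apply/cvg_ex; eexists; exact: H.
  by apply: nearW => n; rewrite leNgt; apply/negP/na.
(* By [cube_eball], a cube of this radius lies in the Euclidean ball of radius 1 / (n + 1), the
   amount by which the ball was shrunk. *)
pose e : R := d%:R^-1 * n.+1%:R^-1.
have e0 : 0 < e by rewrite mulr_gt0 ?invr_gt0 ?ltr0n.
exists e => [//|z zy]; apply: (lt_le_trans an).
apply: ge0_subset_integral; [exact: measurable_eball|exact: measurable_eball|
  exact: measurable_funTS|by []|].
apply: eball_sub; rewrite addrCA gerDl subr_le0.
have := cube_eball d0 zy; rewrite /e mulVKf ?pnatr_eq0 -?lt0n//.
by rewrite /eball/= -/(edist z y) edistC => /ltW.
Qed.

End euclidean_balls.

Section local_estimate.
Context {R : realType} {d : nat}.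
Local Notation T := (Rd R d).
Local Notation mu := (@lebesgue_Rd R d).
Implicit Types (h : T -> R) (x y z : 'rV[R]_d).

(** Plays the part of Hoelder's inequality. Pointwise h <= s + s^(1 - q) h^q, according to whether h
    <= s or not; integrated over the ball, the two terms give at most s (2t)^d and s t^d. *)
Lemma integral_le_power_mean h y (q s t : R) :
  measurable_fun [set: T] h -> (forall x, 0 <= h x) ->
  1 < q -> 0 <= s -> 0 < t ->
  (\int[mu]_(x in eball y t) (h x `^ q)%:E <= (s `^ q * t ^+ d)%:E)%E ->
  (\int[mu]_(x in eball y t) (h x)%:E <= ((2 ^+ d + 1) * s * t ^+ d)%:E)%E.
Proof.
move=> mh h0 q1 s0 t0; have q0 : 0 < q by exact: lt_trans q1.
have td : 0 < t ^+ d by rewrite exprn_gt0.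
have c0 : 0 < (2 ^+ d + 1) * t ^+ d :> R.
  by rewrite mulr_gt0// ltr_wpDl// exprn_ge0.
wlog s1 : s s0 / 0 < s => [hwlog|].
  move=> hs; apply/lee_addgt0Pr => e e0.
  (* The case s = 0, where s^(1 - q) is of no use, is reached by perturbation: this increment raises
     the bound by exactly [e]. *)
  pose s' := s + e / ((2 ^+ d + 1) * t ^+ d).
  have ss' : s < s' by rewrite ltrDl divr_gt0.
  have s'0 : 0 < s' by exact: le_lt_trans ss'.
  apply: le_trans (hwlog _ (ltW s'0) s'0 _) _.
    apply: (le_trans hs); rewrite lee_fin ler_wpM2r ?(ltW td)//.
    by apply: ge0_ler_powR; rewrite ?nnegrE// ltW.
  rewrite -EFinD lee_fin /s' mulrAC mulrDr (mulrAC _ s) lerD2l.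
  by rewrite mulrCA divff ?gt_eqF// mulr1.
move=> hs; have mB := @measurable_eball R d y t.
have mhq : measurable_fun (eball y t) (fun x => (h x `^ q)%:E).
  apply/measurable_EFinP/measurable_funTS.
  exact: measurableT_comp (measurable_powR _) mh.
apply: (@le_trans _ _ (\int[mu]_(x in eball y t)
    (s%:E + (s `^ (1 - q))%:E * (h x `^ q)%:E))%E).
  apply: le_integral_nonmeasurable => x _; first by rewrite lee_fin.
  rewrite -EFinM -EFinD lee_fin; have [hs'|sh] := leP (h x) s.
    by rewrite ler_wpDr// mulr_ge0// powR_ge0.
  rewrite ler_wpDl// -(mulr_powRB1 (h0 x) q0) mulrCA ler_peMr//.
  rewrite -opprB powRN -ler_pdivrMl ?invr_gt0 ?powR_gt0// invrK mulr1.
  by apply: ge0_ler_powR; rewrite ?nnegrE ?subr_ge0// ltW.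
rewrite (ge0_integralD _ mB); last 4 first.
- by move=> x _; rewrite lee_fin.
- exact: measurable_cst.
- by move=> x _; rewrite -EFinM lee_fin mulr_ge0 ?powR_ge0.
- exact: emeasurable_funM (measurable_cst _) mhq.
rewrite integral_cst// ge0_integralZl//; last 2 first.
- by move=> x _; rewrite lee_fin powR_ge0.
- by rewrite lee_fin powR_ge0.
apply: (@le_trans _ _ (s%:E * ((2 * t) ^+ d)%:E + (s `^ (1 - q))%:E *
    (s `^ q * t ^+ d)%:E)%E).
  apply: leeD; apply: lee_wpmul2l => //; rewrite ?lee_fin ?powR_ge0 ?(ltW s1)//.
  exact: eball_measure_le.
rewrite -!EFinM -EFinD lee_fin mulrA -powRD; last by rewrite (gt_eqF s1) implybT.
by rewrite subrK powRr1 ?(ltW s1)// exprMn le_eqVlt; apply/orP; left; apply/eqP; ring.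
Qed.

Definition ball_maximal h (x : T) : \bar R :=
  ereal_sup [set ((r ^- d)%:E * \int[mu]_(y in eball x r) (h y)%:E)%E |
    r in `]0, +oo[%classic].

Lemma ball_maximal_ge0 h x : (forall x, 0 <= h x) -> (0 <= ball_maximal h x)%E.
Proof.
move=> h0; apply: le_trans (ereal_sup_ubound _); last first.
  by exists 1; rewrite //= in_itv/= ltr01.
apply: mule_ge0; first by rewrite lee_fin invr_ge0 expr1n.
by apply: integral_ge0 => y _; rewrite lee_fin.
Qed.

Lemma ball_average_le_maximal h x (r : R) : 0 < r ->
  (\int[mu]_(y in eball x r) (h y)%:E <= (r ^+ d)%:E * ball_maximal h x)%E.
Proof.
move=> r0; have rd : 0 < r ^+ d by rewrite exprn_gt0.
rewrite -lee_pdivrMl//; apply: ereal_sup_ubound; exists r => //=.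
by rewrite in_itv/= r0.
Qed.

(** [s] bounds the power means of order q of [h] over all dyadic dilations of the ball. For x in
    B(y, r), averages of radius at most r see only [h1], whose q-th power is controlled by the
    hypothesis at k = 0 and the strong type; averages of larger radius are at most a multiple of
    [s]. *)
Lemma ball_maximal_local (q : R) : 1 < q -> exists2 C : R, 0 < C &
  forall h y (r s : R), measurable_fun [set: T] h -> (forall x, 0 <= h x) ->
    0 < r -> 0 <= s ->
    (forall k : nat, (\int[mu]_(x in eball y (2 ^+ k.+1 * r)) (h x `^ q)%:E <=
      (s `^ q * (2 ^+ k.+1 * r) ^+ d)%:E)%E) ->
    (\int[mu]_(x in eball y r) ball_maximal h x `^ q <=
      (C * (s `^ q * r ^+ d))%:E)%E.
Proof.
move=> q1; have q0 : 0 < q by exact: lt_trans q1.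
have [C C0 strong] := @maximal_strong R d q q1.
pose A : R := (2 ^+ d + 1) * 4 ^+ d.
have A0 : 0 < A by rewrite mulr_gt0 ?exprn_gt0// ltr_wpDl// exprn_ge0.
pose C1 := (4 ^+ d) `^ q * C * 2 ^+ d; pose C2 := A `^ q * 2 ^+ d.
have C10 : 0 < C1 by rewrite !mulr_gt0 ?powR_gt0 ?exprn_gt0.
have C20 : 0 < C2 by rewrite !mulr_gt0 ?powR_gt0 ?exprn_gt0.
exists (C1 + C2); first exact: addr_gt0.
move=> h y r s mh h0 r0 s0 hN.
pose B : set T := eball y (2 * r).
have mB : measurable B by exact: measurable_eball.
pose h1 x := h x * \1_B x.
have h10 x : 0 <= h1 x by rewrite mulr_ge0// indicE.
have mh1 : measurable_fun [set: T] h1.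
  by apply: measurable_funM => //; exact: measurable_indic.
have pointwise x : eball y r x ->
    (ball_maximal h x `^ q <=
      ((4 ^+ d) `^ q)%:E * maximal h1 x `^ q + ((A * s) `^ q)%:E)%E.
  move=> xy; have m1 := maximal_ge0 x h10.
  have b0 := ball_maximal_ge0 x h0.
  have M4 : (0 <= (4 ^+ d)%:E * maximal h1 x)%E.
    by rewrite mule_ge0// lee_fin exprn_ge0.
  have : (ball_maximal h x <= maxe ((4 ^+ d)%:E * maximal h1 x) (A * s)%:E)%E.
    apply: ge_ereal_sup => _ [p /= + <-]; rewrite in_itv/= andbT => p0.
    have pd : 0 < p ^+ d by rewrite exprn_gt0.
    rewrite le_max; apply/orP.
    have [pr|rp] := leP p r.
      left; rewrite lee_pdivrMl// muleA -EFinM -exprMn (mulrC p).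
      have <- : (\int[mu]_(z in eball x p) (h1 z)%:E =
          \int[mu]_(z in eball x p) (h z)%:E)%E.
        apply: eq_integral => z; rewrite inE => zx; rewrite /h1 indicE mem_set ?mulr1//.
        apply: eball_sub zx; rewrite mulr2n mulrDl mul1r lerD// ltW//.
      exact: average_le_maximal.
    right; rewrite lee_pdivrMl//.
    have [k0 k0p] := exists_dyadic_gt p r0.
    have exP : exists k, p <= r * 2 ^+ k by exists k0; exact: ltW.
    case: (ex_minnP exP) => k pk kmin.
    (* Minimality of [k] makes the radius 2^(k+1) r of the enclosing ball at most 4p, whence the
       factor 4^d in [A]. *)
    have kp : r * 2 ^+ k <= 2 * p.
      case: k pk kmin => [|m] pm kmin; first by rewrite expr0 mulr1; lra.
      have : r * 2 ^+ m < p.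
        by rewrite ltNge; apply/negP => /kmin; rewrite ltnn.
      by rewrite exprS; lra.
    apply: (@le_trans _ _ (\int[mu]_(z in eball y (2 ^+ k.+1 * r)) (h z)%:E)%E).
      apply: ge0_subset_integral; [exact: measurable_eball|exact: measurable_eball| | |].
      - by apply/measurable_EFinP; exact: measurable_funS mh.
      - by move=> z _; rewrite lee_fin.
      - apply: eball_sub; rewrite exprS -mulrA (mulrC _ r).
        have : edist x y < r by exact: xy.
        lra.
    have kr0 : 0 < 2 ^+ k.+1 * r by rewrite mulr_gt0 ?exprn_gt0.
    apply: le_trans (integral_le_power_mean mh h0 q1 s0 kr0 (hN k)) _.
    rewrite -EFinM lee_fin [leRHS](_ : _ = (2 ^+ d + 1) * s * (4 * p) ^+ d);
      last by rewrite /A exprMn; ring.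
    rewrite ler_wpM2l//; first by rewrite mulr_ge0// addr_ge0// exprn_ge0.
    rewrite lerXn2r// ?nnegrE ?(ltW kr0) ?mulr_ge0 ?(ltW p0)//.
    by rewrite exprS; lra.
  move=> /(gt0_ler_poweR (ltW q0)) => /(_ _ _)/le_trans; apply.
  - by rewrite in_itv/= b0 leey.
  - by rewrite in_itv/= leey andbT le_max M4.
  have [_|_] := leP ((4 ^+ d)%:E * maximal h1 x)%E ((A * s)%:E).
    rewrite -[leLHS]add0e; apply: leeD; rewrite ?poweR_EFin//.
    by rewrite mule_ge0 ?poweR_ge0// lee_fin powR_ge0.
  rewrite -[leLHS]adde0; apply: leeD; rewrite ?lee_fin ?powR_ge0//.
  by rewrite poweRM// lee_fin exprn_ge0.
have mBr : measurable (eball y r : set T) by exact: measurable_eball.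
have mM : measurable_fun (eball y r : set T) (fun x => maximal h1 x `^ q)%E.
  apply: measurable_funTS.
  exact: measurableT_comp (measurable_poweR _) (measurable_maximal h1).
apply: le_trans (le_integral_nonmeasurable mu _ pointwise) _.
  by move=> x _; exact: poweR_ge0.
have fB : (mu (eball y r) < +oo)%E.
  by apply: le_lt_trans (eball_measure_le y r0) _; rewrite ltry.
rewrite (ge0_integralD _ mBr); last 4 first.
- by move=> x _; rewrite mule_ge0 ?poweR_ge0// lee_fin powR_ge0.
- exact: emeasurable_funM (measurable_cst _) mM.
- by move=> x _; rewrite lee_fin powR_ge0.
- exact: measurable_cst.
rewrite (ge0_integralZl _ mBr mM); last 2 first.
- by move=> x _; rewrite poweR_ge0.
- by rewrite lee_fin powR_ge0.
rewrite integral_cst// mulrDl EFinD; apply: leeD; last first.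
  apply: (@le_trans _ _ (((A * s) `^ q)%:E * ((2 * r) ^+ d)%:E)%E).
    by apply: lee_wpmul2l; rewrite ?lee_fin ?powR_ge0//; exact: eball_measure_le.
  rewrite -EFinM lee_fin powRM ?(ltW A0)// exprMn /C2 le_eqVlt; apply/orP; left.
  by apply/eqP; ring.
rewrite /C1 -!mulrA EFinM; apply: lee_wpmul2l; first by rewrite lee_fin powR_ge0.
apply: le_trans (strong _ _ mh1 h10 mBr fB) _.
rewrite EFinM; apply: lee_wpmul2l; first by rewrite lee_fin ltW.
have -> : 2 ^+ d * (s `^ q * r ^+ d) = s `^ q * (2 ^+ 1 * r) ^+ d.
  by rewrite expr1 exprMn mulrCA.
apply: le_trans (hN 0%N); rewrite expr1 -/B [leRHS]integral_mkcond.
rewrite le_eqVlt; apply/orP; left; apply/eqP; apply: eq_integral => x _.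
rewrite /h1 /patch indicE; case: ifP => _; first by rewrite mulr1.
by rewrite mulr0 powR0// gt_eqF.
Qed.

End local_estimate.

(** * Dyadic sums of the growth function *)

Section growth.
Context {R : realType}.

Lemma dyadic_sum_le_integral (G : R -> R) (c : nat -> R) (r : R) (n : nat) :
  0 < r -> (forall t, r < t -> 0 <= G t) -> (forall k, 0 <= c k) ->
  (forall k t, 2 ^+ k * r < t <= 2 ^+ k.+1 * r -> c k <= G t) ->
  ((\sum_(k < n) c k * (2 ^+ k * r))%:E <=
    \int[lebesgue_measure]_(t in `]r, +oo[) (G t)%:E)%E.
Proof.
move=> r0 G0 c0 cG.
pose J k : set R := `]2 ^+ k * r, 2 ^+ k.+1 * r]%classic.
have mJ k : measurable (J k) by exact: measurable_itv.
have mD : measurable (`]r, +oo[%classic : set R) by exact: measurable_itv.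
have mI k : measurable_fun (`]r, +oo[%classic : set R) (fun t => (\1_(J k) t : R)%:E).
  by apply/measurable_EFinP; exact: measurable_indic.
have JD k : J k `<=` `]r, +oo[%classic.
  move=> t; rewrite /J/= !in_itv/= andbT => /andP[+ _]; apply: le_lt_trans.
  by rewrite ler_peMl ?(ltW r0)// exprn_ege1// ler1n.
have lt2 k : 2 ^+ k * r < 2 ^+ k.+1 * r.
  by rewrite ltr_pM2r// exprS ltr_pMl ?exprn_gt0// ltr1n.
apply: (@le_trans _ _ (\int[lebesgue_measure]_(t in `]r, +oo[)
    (\sum_(k < n) (c k * \1_(J k) t)%:E))%E).
  rewrite ge0_integral_sum//; last 2 first.
  - move=> k; apply/measurable_EFinP; apply: measurable_funM => //.
    exact: measurable_indic (mJ k).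
  - by move=> k t _; rewrite lee_fin mulr_ge0// indicE.
  rewrite le_eqVlt; apply/orP; left; apply/eqP.
  rewrite -sumEFin; apply: eq_bigr => k _.
  under eq_integral do rewrite EFinM.
  rewrite ge0_integralZl//; [|exact: mI|by rewrite lee_fin].
  rewrite integral_indic//=; last exact: mJ.
  rewrite setIidl; last exact: JD.
  rewrite EFinM; congr (_ * _)%E.
  rewrite /J; have := lebesgue_measure_itv `]2 ^+ k * r, 2 ^+ k.+1 * r].
  rewrite /= lte_fin lt2 => ->; rewrite -EFinB; congr EFin.
  by rewrite exprS; ring.
apply: le_integral_nonmeasurable => t; rewrite /= in_itv/= andbT => rt.
  by apply: sume_ge0 => k _; rewrite lee_fin mulr_ge0// indicE.
rewrite sumEFin lee_fin; elim: n => [|n IH]; first by rewrite big_ord0 G0.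
rewrite big_ord_recr/= indicE; case: (boolP (t \in J n)) => [|_]; last first.
  by rewrite mulr0 addr0.
rewrite inE /J/= in_itv/= mulr1 => tJ; rewrite big1 ?add0r; first exact: cG.
move=> k _; rewrite indicE memNset ?mulr0// /J/= in_itv/= => /andP[_].
move: tJ => /andP[nt _] tk; have := lt_le_trans nt tk; apply/negP.
by rewrite -leNgt ler_pM2r// ler_weXn2l// ler1n.
Qed.

(** Let g(t) = phi(t) t^e. On the k-th dyadic interval g is at least g(2^(k+1) r) / C1, and the
    integral of 1 / t is at least 1 / 2, which bounds the sum of q-th powers. The remaining power p
    - q is bounded by (C1 g(r))^(p - q), as g is almost decreasing. *)
Lemma growth_dyadic_sum (phi : R -> R) (q e C1 C : R) :
  0 < q -> 0 < C1 -> 0 < C ->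
  (forall t, 0 < t -> 0 < phi t) ->
  (forall r s, 0 < r -> r <= s -> phi s * s `^ e <= C1 * (phi r * r `^ e)) ->
  (forall r, 0 < r -> (\int[lebesgue_measure]_(t in `]r, +oo[)
     (phi t `^ q * t `^ (e * q - 1))%:E <=
     (C * (phi r `^ q * r `^ (e * q)))%:E)%E) ->
  forall (p r : R) (n : nat), q <= p -> 0 < r ->
  \sum_(k < n) (phi (2 ^+ k.+1 * r) * (2 ^+ k.+1 * r) `^ e) `^ p <=
    2 * C1 `^ p * C * (phi r * r `^ e) `^ p.
Proof.
move=> q0 C10 C0 phi0 dec int p r n qp r0.
pose g t := phi t * t `^ e.
have g0 t : 0 < t -> 0 < g t by move=> t0; rewrite mulr_gt0 ?phi0// powR_gt0.
have tk k : 0 < 2 ^+ k * r by rewrite mulr_gt0// exprn_gt0.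
have gq t : 0 < t -> phi t `^ q * t `^ (e * q) = g t `^ q.
  by move=> t0; rewrite powRM ?(ltW (phi0 _ t0))// ?powR_ge0// powRrM.
have gq1 t : 0 < t -> phi t `^ q * t `^ (e * q - 1) = g t `^ q * t^-1.
  move=> t0; rewrite -gq// powRD; last by rewrite (gt_eqF t0) implybT.
  by rewrite powR_inv1 ?(ltW t0)// mulrA.
pose c k := C1 `^ (- q) * g (2 ^+ k.+1 * r) `^ q * (2 ^+ k.+1 * r)^-1.
have c0 k : 0 <= c k by rewrite !mulr_ge0 ?powR_ge0// invr_ge0 ltW// tk.
have sumq : \sum_(k < n) g (2 ^+ k.+1 * r) `^ q <= 2 * C1 `^ q * C * g r `^ q.
  have := @dyadic_sum_le_integral (fun t => phi t `^ q * t `^ (e * q - 1)) c r n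
    r0 _ c0 _.
  have H1 t : r < t -> 0 <= phi t `^ q * t `^ (e * q - 1).
    by move=> _; rewrite mulr_ge0 ?powR_ge0.
  have H2 k t : 2 ^+ k * r < t <= 2 ^+ k.+1 * r ->
      c k <= phi t `^ q * t `^ (e * q - 1).
    move=> /andP[kt tk1]; have t0 : 0 < t by exact: lt_trans kt.
    rewrite gq1// /c; apply: ler_pM.
    - by rewrite mulr_ge0 ?powR_ge0.
    - by rewrite invr_ge0 ltW// tk.
    - rewrite powRN ler_pdivrMl ?powR_gt0// -powRM ?(ltW C10) ?(ltW (g0 _ t0))//.
      apply: ge0_ler_powR; rewrite ?nnegrE ?(ltW q0)//.
      + by rewrite ltW// g0// tk.
      + by rewrite mulr_ge0 ?(ltW C10) ?(ltW (g0 _ t0)).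
      + exact: dec.
    - by rewrite lef_pV2 ?posrE ?tk.
  move=> /(_ H1 H2) /le_trans /(_ (int _ r0)); rewrite lee_fin gq//.
  have -> : \sum_(k < n) c k * (2 ^+ k * r) =
      (2^-1 * C1 `^ (- q)) * \sum_(k < n) g (2 ^+ k.+1 * r) `^ q.
    rewrite mulr_sumr; apply: eq_bigr => k _; rewrite /c exprS.
    move: (tk k) => /gt_eqF; move: (g _ `^ q) => u.
    rewrite -(mulrA 2); move: (2 ^+ k * r) => t t0.
    by field; rewrite t0.
  have Cq : 0 < C1 `^ q by rewrite powR_gt0.
  rewrite powRN -invfM ler_pdivrMl; last by rewrite mulr_gt0.
  by rewrite !mulrA.
rewrite -[leRHS]/(2 * C1 `^ p * C * g r `^ p).
rewrite -[leLHS]/(\sum_(k < n) g (2 ^+ k.+1 * r) `^ p).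
have pq0 : 0 <= p - q by rewrite subr_ge0.
have split_p u : 0 < u -> u `^ p = u `^ (p - q) * u `^ q.
  by move=> u0; rewrite -powRD ?subrK// (gt_eqF u0) implybT.
apply: (@le_trans _ _ ((C1 * g r) `^ (p - q) * \sum_(k < n) g (2 ^+ k.+1 * r) `^ q)).
  rewrite mulr_sumr; apply: ler_sum => k _.
  rewrite (split_p (g (2 ^+ k.+1 * r))); last exact/g0/tk.
  rewrite ler_wpM2r ?powR_ge0//; apply: ge0_ler_powR; rewrite ?nnegrE//.
  - by rewrite ltW// g0 ?tk.
  - by rewrite ltW// mulr_gt0 ?g0.
  - by apply: dec => //; rewrite ler_peMl ?(ltW r0)// exprn_ege1// ler1n.
rewrite (split_p C1)// (split_p (g r)); last exact: g0.
apply: (le_trans (ler_wpM2l (powR_ge0 _ _) sumq)).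
rewrite powRM ?(ltW C10) ?(ltW (g0 _ r0))//.
by rewrite le_eqVlt; apply/orP; left; apply/eqP; ring.
Qed.

End growth.

(** * Mixed norms *)

Section norms.
Context d (T : measurableType d) (R : realType)
  (mu : {measure set T -> \bar R}).

(** Valid for nonmeasurable [f]: a simple function g below k f gives the simple function g / k below
    f. *)
Lemma ge0_integralZl_le (k : R) (f : T -> \bar R) :
  0 <= k -> (forall x, (0 <= f x)%E) ->
  (\int[mu]_x (k%:E * f x) <= k%:E * \int[mu]_x f x)%E.
Proof.
move=> k0 f0; have [->|kn0] := eqVneq k 0.
  by under eq_integral do rewrite mul0e; rewrite integral0 mul0e.
have {kn0}k0' : 0 < k by rewrite lt_def kn0.
rewrite ge0_integralTE; last by move=> x; rewrite mule_ge0// lee_fin.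
apply: ge_ereal_sup => _ [g /= gkf <-].
rewrite -integralT_nnsfun.
have -> : (\int[mu]_x (g x)%:E)%E = (\int[mu]_x (k%:E * (k^-1 * g x)%:E))%E.
  by apply: eq_integral => x _; rewrite -EFinM mulVKf// gt_eqF.
have g0 x : (0 <= (k^-1 * g x)%:E)%E by rewrite lee_fin mulr_ge0 ?invr_ge0.
rewrite ge0_integralZl//; last first.
  by apply/measurable_EFinP; exact: measurable_funM.
apply: lee_wpmul2l; first by rewrite lee_fin.
by apply: le_integral_nonmeasurable => x _ //; rewrite EFinM lee_pdivrMl.
Qed.

Lemma Lnorm_restrict (D : set T) (q : R) (g : T -> \bar R) : 0 < q ->
  'N[mu]_(q%:E)[g \_ D]%E = ((\int[mu]_(x in D) `|g x| `^ q) `^ q^-1)%E.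
Proof.
move=> q0; rewrite unlock [in RHS]integral_mkcond; congr (_ `^ _)%E.
apply: eq_integral => x _; rewrite /patch; case: ifP => // _.
by rewrite abse0 poweR0r// gt_eqF.
Qed.

(** The exponent P on the left satisfies tau P = p, so |u|^P <= c^P v^p. For p = +oo it is again
    +oo, the inverse of 0. It serves both for the inner norm and for the outer one. *)
Lemma Lnorm_le_powR (p : \bar R) (tau c : R) (u v : T -> \bar R) :
  (0 < p)%E -> 0 < tau -> 0 <= c -> (forall x, (0 <= v x)%E) ->
  (forall x, (`|u x| <= c%:E * v x `^ tau)%E) ->
  ('N[mu]_((p^-1 * tau%:E)^-1)[u] <= c%:E * ('N[mu]_p[v]) `^ tau)%E.
Proof.
move=> p0 t0 c0 v0 uv; case: p p0 => [p| |//] p0.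
  have {}p0 : 0 < p by rewrite -lte_fin.
  rewrite inver (gt_eqF p0) -EFinM inver gt_eqF ?mulr_gt0 ?invr_gt0//.
  rewrite unlock invrK; set P := (p^-1 * tau)^-1.
  have P0 : 0 < P by rewrite invr_gt0 mulr_gt0 ?invr_gt0.
  have tP : tau * P = p by rewrite /P invfM invrK mulrC divfK ?gt_eqF.
  apply: (@le_trans _ _ (((c `^ P)%:E * \int[mu]_x (v x `^ p)) `^ (p^-1 * tau))%E).
    apply: gt0_ler_poweR; first by rewrite ltW// mulr_gt0 ?invr_gt0.
    - by rewrite in_itv/= leey andbT; apply: integral_ge0 => *; exact: poweR_ge0.
    - rewrite in_itv/= leey andbT mule_ge0 ?lee_fin ?powR_ge0//.
      by apply: integral_ge0 => *; exact: poweR_ge0.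
    apply: le_trans (ge0_integralZl_le _ _); rewrite ?powR_ge0//; last first.
      by move=> x; exact: poweR_ge0.
    apply: le_integral_nonmeasurable => x _; first exact: poweR_ge0.
    rewrite -tP poweRrM -poweR_EFin -poweRM ?lee_fin ?poweR_ge0//.
    apply: gt0_ler_poweR (uv x); first exact: ltW.
    - by rewrite in_itv/= leey abse_ge0.
    - by rewrite in_itv/= leey andbT mule_ge0 ?poweR_ge0 ?lee_fin.
  rewrite poweRM; last 2 first.
  - by rewrite lee_fin powR_ge0.
  - by apply: integral_ge0 => *; exact: poweR_ge0.
  rewrite poweR_EFin -powRrM /P mulVf ?gt_eqF ?mulr_gt0 ?invr_gt0// powRr1//.
  rewrite poweRrM (eq_integral (fun x => `|v x| `^ p)%E)//.
  by move=> x _; rewrite gee0_abs.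
rewrite invey mul0e inve0 unlock; case: ifPn => mu0; last first.
  by rewrite mule_ge0 ?lee_fin ?poweR_ge0.
apply/ess_supP; near=> x.
apply: le_trans (uv x) _; apply: lee_wpmul2l; first by rewrite lee_fin.
have vE : (v x <= ess_sup mu (abse \o v))%E.
  by rewrite -(gee0_abs (v0 x)); near: x; exact: ess_sup_ge.
apply: (gt0_ler_poweR _ _ _ vE); first exact: ltW.
- by rewrite in_itv/= leey v0.
- by rewrite in_itv/= leey andbT; exact: le_trans vE.
Unshelve. all: by end_near. Qed.

End norms.

Section amalgams.
Context {R : realType} {d : nat}.
Local Notation T := (Rd R d).
Local Notation mu := (@lebesgue_Rd R d).
Implicit Types (h : T -> R) (x y z : 'rV[R]_d).

Lemma Lnorm_eball h y (q t : R) : 0 < q -> (forall x, 0 <= h x) ->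
  'N[mu]_(q%:E)[(EFin \o h) \_ (eball y t)]%E =
  ((\int[mu]_(x in eball y t) (h x `^ q)%:E) `^ q^-1)%E.
Proof.
move=> q0 h0; rewrite (Lnorm_restrict _ _ _ q0); congr (_ `^ _)%E.
by apply: eq_integral => x _; rewrite /= ger0_norm.
Qed.

Lemma eball_measure_gt0 (y : 'rV[R]_d) (r : R) : (0 < d)%N -> 0 < r ->
  (0 < mu (eball y r))%E.
Proof.
move=> d0 r0; apply: lt_le_trans (eball_measure_ge y d0 r0).
by rewrite lte_fin exprn_gt0// mulr_gt0// invr_gt0 ltr0n.
Qed.

(* If [y] lies within [t] of [z] then the ball of radius [t] about [z] is
   contained in the ball of radius [2 t] about [y]. *)
Lemma Lnorm_eball_le_amalgam h z (q t B : R) (p : \bar R) :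
  (0 < d)%N -> 0 < q -> (0 < p)%E -> (forall x, 0 <= h x) ->
  measurable_fun [set: T] h -> 0 < t -> 0 <= B ->
  (amalgam_norm q%:E p (2 * t) (EFin \o h) <= B%:E)%E ->
  ((\int[mu]_(x in eball z t) (h x `^ q)%:E) `^ q^-1 <=
    (B * (d%:R^-1 * t) `^ (- (d%:R * recip p)))%:E)%E.
Proof.
move=> d0 q0 p0 h0 mh t0 B0.
set X := ((\int[mu]_(x in eball z t) (h x `^ q)%:E) `^ q^-1)%E.
have X0 : (0 <= X)%E by exact: poweR_ge0.
have dt0 : 0 < d%:R^-1 * t :> R by rewrite mulr_gt0// invr_gt0 ltr0n.
have XN y : eball z t y ->
    (X <= 'N[mu]_(q%:E)[(EFin \o h) \_ (eball y (2 * t))])%E.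
  move=> yz; rewrite Lnorm_eball//; apply: gt0_ler_poweR.
  - by rewrite invr_ge0 ltW.
  - rewrite in_itv/= leey andbT; apply: integral_ge0 => x _.
    by rewrite lee_fin powR_ge0.
  - rewrite in_itv/= leey andbT; apply: integral_ge0 => x _.
    by rewrite lee_fin powR_ge0.
  apply: ge0_subset_integral; [exact: measurable_eball|exact: measurable_eball| | |].
  - apply/measurable_EFinP/measurable_funTS.
    exact: measurableT_comp (measurable_powR _) mh.
  - by move=> x _; rewrite lee_fin powR_ge0.
  - by apply: eball_doubling; rewrite edistC; exact: yz.
rewrite /amalgam_norm; set N := (fun y => Lnorm _ _ _).
have XN' y : eball z t y -> (X <= `|N y|)%E.
  by move=> yz; rewrite gee0_abs ?Lnorm_ge0//; exact: XN.
case: p p0 => [p| |//] p0 NB.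
  have {}p0 : 0 < p by rewrite -lte_fin.
  have -> : recip p%:E = p^-1 by rewrite /recip inver (gt_eqF p0).
  have mE : measurable (eball z t : set T) by exact: measurable_eball.
  have : (X * ((d%:R^-1 * t) `^ (d%:R / p))%:E <= B%:E)%E.
    apply: le_trans NB; rewrite unlock.
    have -> : (X * ((d%:R^-1 * t) `^ (d%:R / p))%:E =
        (X `^ p * ((d%:R^-1 * t) ^+ d)%:E) `^ p^-1)%E.
      rewrite poweRM ?poweR_ge0 ?lee_fin ?exprn_ge0 ?(ltW dt0)//.
      rewrite -poweRrM divff ?gt_eqF// poweRe1// poweR_EFin.
      by rewrite -powR_mulrn ?(ltW dt0)// -powRrM.
    have Y0 : (0 <= X `^ p * ((d%:R^-1 * t) ^+ d)%:E)%E.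
      by rewrite mule_ge0 ?poweR_ge0// lee_fin exprn_ge0 ?(ltW dt0).
    apply: gt0_ler_poweR; first by rewrite invr_ge0 ltW.
    - by rewrite in_itv/= leey andbT.
    - by rewrite in_itv/= leey andbT; apply: integral_ge0 => *; exact: poweR_ge0.
    apply: (@le_trans _ _ (\int[mu]_(y in eball z t) (X `^ p))%E).
      rewrite integral_cst//; apply: lee_wpmul2l; first exact: poweR_ge0.
      exact: eball_measure_ge.
    rewrite [leLHS]integral_mkcond; apply: le_integral_nonmeasurable => y _.
      by rewrite /patch; case: ifP => _ //; exact: poweR_ge0.
    rewrite /patch; case: ifPn => [/set_mem yz|_]; last exact: poweR_ge0.
    apply: gt0_ler_poweR; rewrite ?(ltW p0)//.
    - by rewrite in_itv/= leey andbT.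
    - by rewrite in_itv/= leey andbT abse_ge0.
    exact: XN'.
  by rewrite -lee_pdivlMr ?powR_gt0// EFinM powRN.
rewrite /recip invey mulr0 oppr0 powRr0 mulr1; apply: le_trans NB.
rewrite unlock ifT; last first.
  apply: lt_le_trans (eball_measure_gt0 z d0 t0) _.
  by apply: le_measure; rewrite ?inE//; exact: measurable_eball.
rewrite leNgt; apply/negP => NX.
(* If the essential supremum were below [X], this null set would contain the whole ball B(z, t),
   which has positive measure. *)
have [A [mA A0 subA]] := ess_sup_ge mu (abse \o N).
have : (mu (eball z t) <= mu A)%E.
  apply: le_lebesgue_outer => y yz; apply: subA => /=; apply/negP; rewrite -ltNge.
  apply: lt_le_trans NX _; exact: XN'.
by rewrite leNgt => /negP; apply; rewrite (A0 : mu A = 0%E) eball_measure_gt0.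
Qed.

End amalgams.

(** * Boundedness of the ball maximal function on generalized Fofana spaces *)

Section fofana_maximal.
Context {R : realType} {d : nat}.
Local Notation T := (Rd R d).
Local Notation mu := (@lebesgue_Rd R d).
Implicit Types (h : T -> R) (x y z : 'rV[R]_d) (phi : R -> R).

Lemma amalgam_ball_maximal_oo (q C1 : R) phi :
  (0 < d)%N -> 1 < q -> 0 < C1 -> (forall t, 0 < t -> 0 < phi t) ->
  (forall r s, 0 < r -> r <= s -> phi s <= C1 * phi r) ->
  exists2 K : R, 0 < K & forall h (F r : R),
    measurable_fun [set: T] h -> (forall x, 0 <= h x) -> 0 <= F -> 0 < r ->
    (forall t, 0 < t -> (amalgam_norm q%:E +oo t (EFin \o h) <=
      (F * (phi t * t `^ (d%:R / q)))%:E)%E) ->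
    (amalgam_norm q%:E +oo r (ball_maximal h) <=
      (K * F * (phi r * r `^ (d%:R / q)))%:E)%E.
Proof.
move=> d0 q1 C10 phi0 dec; have q0 : 0 < q by exact: lt_trans q1.
have [C0 C00 loc] := @ball_maximal_local R d q q1.
(* Passing from an essential bound to one at every centre doubles the radius: this costs 2^(d/q),
   while phi(2t) <= C1 phi(r). *)
pose A := C1 * 2 `^ (d%:R / q).
have A0 : 0 < A by rewrite mulr_gt0 ?powR_gt0.
exists (C0 `^ q^-1 * A); first by rewrite mulr_gt0// powR_gt0.
move=> h F r mh h0 F0 r0 hF.
have powd t : 0 < t -> t ^+ d = (t `^ (d%:R / q)) `^ q.
  by move=> t0; rewrite -powRrM divfK ?gt_eqF// powR_mulrn// ltW.
pose s := A * F * phi r.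
have s0 : 0 <= s.
  exact: mulr_ge0 (mulr_ge0 (ltW A0) F0) (ltW (phi0 _ r0)).
have Lr y : (\int[mu]_(x in eball y r) ball_maximal h x `^ q <=
    (C0 * (s `^ q * r ^+ d))%:E)%E.
  apply: loc => // k; set t := 2 ^+ k.+1 * r.
  have t0 : 0 < t by rewrite mulr_gt0// exprn_gt0.
  have t20 : 0 < 2 * t by rewrite mulr_gt0.
  have rt : r <= 2 * t.
    rewrite /t mulrA -exprS ler_peMl ?(ltW r0)// exprn_ege1// ler1n//.
  have B0 : 0 <= F * (phi (2 * t) * (2 * t) `^ (d%:R / q)).
    by rewrite !mulr_ge0 ?powR_ge0// ltW// phi0.
  have := Lnorm_eball_le_amalgam y d0 q0 (ltry _) h0 mh t0 B0 (hF _ t20).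
  rewrite /recip invey mulr0 oppr0 powRr0 mulr1 => N1.
  have {}N1 : ((\int[mu]_(x in eball y t) (h x `^ q)%:E) `^ q^-1 <=
      (s * t `^ (d%:R / q))%:E)%E.
    apply: (le_trans N1); rewrite lee_fin powRM ?(ltW t0)// /s /A.
    rewrite [leRHS](_ : _ = F * (C1 * phi r * (2 `^ (d%:R / q) * t `^ (d%:R / q))));
      last by ring.
    apply: ler_wpM2l => //; apply: ler_wpM2r; last exact: dec.
    by rewrite mulr_ge0 ?powR_ge0.
  have N0 : (0 <= \int[mu]_(x in eball y t) (h x `^ q)%:E)%E.
    by apply: integral_ge0 => x _; rewrite lee_fin powR_ge0.
  rewrite -[leLHS]poweRe1// (_ : 1 = q^-1 * q); last by rewrite mulVf ?gt_eqF.
  rewrite poweRrM.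
  rewrite (powd _ t0) -powRM ?powR_ge0// -poweR_EFin.
  apply: (gt0_ler_poweR _ _ _ N1); first exact: ltW.
  - by rewrite in_itv/= leey poweR_ge0.
  - by rewrite in_itv/= leey andbT lee_fin mulr_ge0 ?powR_ge0.
have C0s : 0 <= C0 * (s `^ q * r ^+ d).
  by rewrite !mulr_ge0 ?powR_ge0 ?exprn_ge0 ?ltW.
have Nr y : ('N[mu]_(q%:E)[(ball_maximal h) \_ (eball y r)] <=
    (C0 `^ q^-1 * A * F * (phi r * r `^ (d%:R / q)))%:E)%E.
  rewrite Lnorm_restrict//.
  rewrite (eq_integral (fun x : T => ball_maximal h x `^ q)%E); last first.
    by move=> x _; rewrite gee0_abs// ball_maximal_ge0.
  rewrite [leRHS](_ : _ = (C0 * (s `^ q * r ^+ d))%:E `^ q^-1)%E.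
    apply: gt0_ler_poweR; rewrite ?invr_ge0 ?(ltW q0)//.
    - rewrite in_itv/= leey andbT; apply: integral_ge0 => x _; exact: poweR_ge0.
    - by rewrite in_itv/= leey andbT lee_fin.
  rewrite poweR_EFin (powd _ r0) -powRM ?powR_ge0//.
  rewrite powRM ?powR_ge0 ?(ltW C00)// -powRrM divff ?gt_eqF//.
  rewrite powRr1; last by rewrite mulr_ge0 ?powR_ge0.
  by rewrite /s; congr EFin; ring.
rewrite /amalgam_norm; set N := (fun y => Lnorm _ _ _).
rewrite unlock; case: ifPn => _; last first.
  have CAF : 0 <= C0 `^ q^-1 * A * F.
    exact: mulr_ge0 (mulr_ge0 (powR_ge0 _ _) (ltW A0)) F0.
  by rewrite lee_fin (mulr_ge0 CAF)// mulr_ge0 ?powR_ge0 ?(ltW (phi0 _ r0)).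
apply/ess_supP; apply: nearW => y /=.
by rewrite gee0_abs ?Lnorm_ge0//; exact: Nr.
Qed.

(** The hypothesis on the dyadic sums is what [growth_dyadic_sum] provides with e = d / p.
    Exchanging the sum over radii with the integral in y relies on [measurable_integral_eball]. *)
Lemma amalgam_ball_maximal_fin (q p A : R) phi :
  (0 < d)%N -> 1 < q -> q <= p -> 0 < A -> (forall t, 0 < t -> 0 < phi t) ->
  (forall (r : R) (n : nat), 0 < r ->
    \sum_(k < n) (phi (2 ^+ k.+1 * r) * (2 ^+ k.+1 * r) `^ (d%:R / p)) `^ p <=
    A * (phi r * r `^ (d%:R / p)) `^ p) ->
  exists2 K : R, 0 < K & forall h (F r : R),
    measurable_fun [set: T] h -> (forall x, 0 <= h x) -> 0 <= F -> 0 < r ->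
    (forall t, 0 < t -> (amalgam_norm q%:E p%:E t (EFin \o h) <=
      (F * (phi t * t `^ (d%:R / q + d%:R / p)))%:E)%E) ->
    (amalgam_norm q%:E p%:E r (ball_maximal h) <=
      (K * F * (phi r * r `^ (d%:R / q + d%:R / p)))%:E)%E.
Proof.
move=> d0 q1 qp A0 phi0 sumA; have q0 : 0 < q by exact: lt_trans q1.
have p0 : 0 < p by exact: lt_le_trans qp.
have pq0 : 0 < p / q by rewrite divr_gt0.
have qp0 : 0 < q / p by rewrite divr_gt0.
have pqK : p / q * (q / p) = 1.
  by rewrite mulrA divfK ?gt_eqF// divff// gt_eqF.
have [C0 C00 loc] := @ball_maximal_local R d q q1.
exists ((C0 `^ (p / q) * A) `^ p^-1).
  by rewrite powR_gt0// mulr_gt0// powR_gt0.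
move=> h F r mh h0 F0 r0 hF.
pose t k : R := 2 ^+ k.+1 * r.
have t0 k : 0 < t k by rewrite mulr_gt0// exprn_gt0.
(* Normalization to radius r: [a k * N k y] is r^d times the integral of h^q over B(y, t k) divided
   by (t k)^d. *)
pose a k : R := 2 ^- (k.+1 * d).
have a0 k : 0 < a k by rewrite invr_gt0 exprn_gt0.
have atd k : a k * t k ^+ d = r ^+ d.
  by rewrite /a /t exprMn exprM mulKf// expf_neq0// expf_neq0.
pose N k (y : T) := (\int[mu]_(x in eball y (t k)) (h x `^ q)%:E)%E.
have N0 k y : (0 <= N k y)%E.
  by apply: integral_ge0 => x _; rewrite lee_fin powR_ge0.
have mhq : measurable_fun [set: T] (fun x => (h x `^ q)%:E).
  by apply/measurable_EFinP; exact: measurableT_comp (measurable_powR _) mh.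
have mN k : measurable_fun [set: T] (N k).
  by apply: measurable_integral_eball => // x; rewrite lee_fin powR_ge0.
pose u k y := (((a k)%:E * N k y) `^ (p / q))%E.
have u0 k y : (0 <= u k y)%E by exact: poweR_ge0.
have mu_ k : measurable_fun [set: T] (u k).
  apply: (measurableT_comp (measurable_poweR (p / q))).
  exact: emeasurable_funM.
pose L y := (\int[mu]_(x in eball y r) ball_maximal h x `^ q)%E.
have L0 y : (0 <= L y)%E by apply: integral_ge0 => x _; exact: poweR_ge0.
have LX y : (L y `^ (p / q) <= (C0 `^ (p / q))%:E * \sum_(k <oo) u k y)%E.
  have X0 : (0 <= \sum_(k <oo) u k y)%E by apply: nneseries_ge0 => *; exact: u0.
  case EX : (\sum_(k <oo) u k y)%E X0 => [X| |//] X0; last first.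
    by rewrite mulry gtr0_sg ?powR_gt0// mul1e leey.
  have {}X0 : 0 <= X by rewrite -lee_fin.
  (* Chosen so that the hypothesis of [ball_maximal_local] at index k says exactly that a_k N_k <=
     X^(q/p), that is, u_k <= X. *)
  pose s := (X `^ (q / p) / r ^+ d) `^ q^-1.
  have Xr0 : 0 <= X `^ (q / p) / r ^+ d.
    by rewrite divr_ge0 ?powR_ge0 ?exprn_ge0 ?ltW.
  have sq : s `^ q = X `^ (q / p) / r ^+ d.
    by rewrite -powRrM mulVf ?gt_eqF// powRr1.
  have : (L y <= (C0 * (s `^ q * r ^+ d))%:E)%E.
    apply: loc => //; first exact: powR_ge0.
    move=> k; rewrite sq -/(t k) -/(N k y).
    have : (u k y <= X%:E)%E by rewrite -EX; exact: nneseries_ge_term.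
    move=> /(gt0_ler_poweR (ltW qp0)) => /(_ _ _) uX.
    have {}uX : ((a k)%:E * N k y <= (X `^ (q / p))%:E)%E.
      rewrite -poweR_EFin; apply: le_trans (uX _ _); last 2 first.
      - by rewrite in_itv/= leey andbT.
      - by rewrite in_itv/= leey andbT lee_fin.
      rewrite /u -poweRrM pqK poweRe1//.
      by rewrite mule_ge0// lee_fin ltW.
    have -> : X `^ (q / p) / r ^+ d * t k ^+ d = X `^ (q / p) / a k.
      rewrite -(atd k) invfM -!mulrA mulVf ?mulr1//.
      by rewrite expf_neq0// gt_eqF.
    by rewrite EFinM lee_pdivlMr// muleC.
  rewrite sq divfK; last by rewrite expf_neq0// gt_eqF.
  move=> /(gt0_ler_poweR (ltW pq0)) => /(_ _ _)/le_trans; apply.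
  - by rewrite in_itv/= leey andbT.
  - by rewrite in_itv/= leey andbT lee_fin mulr_ge0 ?powR_ge0 ?ltW.
  rewrite poweR_EFin powRM ?powR_ge0 ?(ltW C00)// -powRrM (mulrC (q / p)) pqK.
  by rewrite powRr1.
have intN k : (\int[mu]_y (N k y `^ (p / q)) <=
    ((F * (phi (t k) * t k `^ (d%:R / q + d%:R / p))) `^ p)%:E)%E.
  have p_neq0 : p != 0 by rewrite gt_eqF.
  rewrite (eq_integral (fun y : T =>
      `|'N[mu]_(q%:E)[(EFin \o h) \_ (eball y (t k))]| `^ p)%E); last first.
    move=> y _; rewrite Lnorm_eball// gee0_abs ?poweR_ge0//.
    by rewrite -poweRrM (mulrC q^-1).
  rewrite -poweR_Lnorm// -poweR_EFin; apply: (gt0_ler_poweR _ _ _ (hF _ (t0 k))).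
  - exact: ltW.
  - by rewrite in_itv/= leey Lnorm_ge0.
  - by rewrite in_itv/= leey andbT lee_fin !mulr_ge0 ?powR_ge0 ?(ltW (phi0 _ (t0 k))).
pose g (x : R) := phi x * x `^ (d%:R / p).
have intu k : (\int[mu]_y u k y <=
    ((F * r `^ (d%:R / q)) `^ p * g (t k) `^ p)%:E)%E.
  rewrite (eq_integral (fun y : T => (a k `^ (p / q))%:E * N k y `^ (p / q))%E);
    last by move=> y _; rewrite /u poweRM// lee_fin ltW.
  apply: le_trans (ge0_integralZl_le _ _ _) _.
  - exact: powR_ge0.
  - by move=> y; exact: poweR_ge0.
  apply: le_trans (lee_wpmul2l _ (intN k)) _; first by rewrite lee_fin powR_ge0.
  (* The normalization [a k] turns t_k^(d/q) into r^(d/q), so only g(t_k), the quantity summed by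
     the growth condition, still depends on k. *)
  have rdq : r `^ (d%:R / q) = a k `^ q^-1 * t k `^ (d%:R / q).
    rewrite !(powRrM _ d%:R) !powR_mulrn ?(ltW r0) ?(ltW (t0 k))//.
    by rewrite -powRM ?exprn_ge0 ?(ltW (a0 k)) ?(ltW (t0 k))// atd.
  have gk0 : 0 <= g (t k) by rewrite mulr_ge0 ?powR_ge0 ?(ltW (phi0 _ (t0 k))).
  have Fr0 : 0 <= F * r `^ (d%:R / q) by rewrite mulr_ge0 ?powR_ge0.
  rewrite -EFinM lee_fin -(powRM _ Fr0 gk0) (mulrC p) powRrM -powRM ?powR_ge0//;
    last by rewrite !mulr_ge0 ?powR_ge0 ?(ltW (phi0 _ (t0 k))).
  rewrite powRD; last by rewrite (gt_eqF (t0 k)) implybT.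
  by rewrite rdq /g le_eqVlt; apply/orP; left; apply/eqP; congr (_ `^ _); ring.
have Fr0 : 0 <= F * r `^ (d%:R / q) by rewrite mulr_ge0 ?powR_ge0.
have gr0 : 0 <= g r by rewrite mulr_ge0 ?powR_ge0 ?(ltW (phi0 _ r0)).
have intX : (\int[mu]_y (\sum_(k <oo) u k y) <=
    ((F * r `^ (d%:R / q)) `^ p * (A * g r `^ p))%:E)%E.
  rewrite integral_nneseries//; apply: lime_le.
    by apply: is_cvg_nneseries => k _ _; apply: integral_ge0.
  apply: nearW => n.
  apply: le_trans (lee_sum _ (fun k _ => intu k)) _.
  rewrite sumEFin lee_fin -mulr_sumr ler_wpM2l ?powR_ge0//.
  by rewrite big_mkord; exact: sumA.
rewrite /amalgam_norm; set NM := (fun y => Lnorm _ _ _).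
rewrite unlock.
have -> : (C0 `^ (p / q) * A) `^ p^-1 * F * (phi r * r `^ (d%:R / q + d%:R / p)) =
    (C0 `^ (p / q) * ((F * r `^ (d%:R / q)) `^ p * (A * g r `^ p))) `^ p^-1.
  rewrite [X in _ = X `^ _](_ : _ =
      (C0 `^ (p / q) * A) * (F * r `^ (d%:R / q) * g r) `^ p); last first.
    by rewrite (powRM _ Fr0 gr0) -mulrA (mulrCA A).
  rewrite [in RHS]powRM ?powR_ge0//; last by rewrite mulr_ge0 ?powR_ge0 ?ltW.
  rewrite -(powRrM _ p) divff ?gt_eqF// powRr1 ?(mulr_ge0 Fr0 gr0)//.
  rewrite /g powRD; last by rewrite (gt_eqF r0) implybT.
  by ring.
rewrite -poweR_EFin; apply: gt0_ler_poweR; first by rewrite invr_ge0 ltW.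
- by rewrite in_itv/= leey andbT; apply: integral_ge0 => *; exact: poweR_ge0.
- by rewrite in_itv/= leey andbT lee_fin !mulr_ge0 ?powR_ge0 ?(ltW A0).
apply: (@le_trans _ _ (\int[mu]_y ((C0 `^ (p / q))%:E * \sum_(k <oo) u k y))%E).
  apply: le_integral_nonmeasurable => y _; first exact: poweR_ge0.
  rewrite gee0_abs ?Lnorm_ge0// /NM Lnorm_restrict//.
  rewrite (eq_integral (fun x : T => ball_maximal h x `^ q)%E); last first.
    by move=> x _; rewrite gee0_abs// ball_maximal_ge0.
  by rewrite -poweRrM (mulrC q^-1); exact: LX.
apply: le_trans (ge0_integralZl_le _ _ _) _.
- exact: powR_ge0.
- by move=> y; apply: nneseries_ge0 => *; exact: u0.
by rewrite EFinM; apply: lee_wpmul2l; rewrite ?lee_fin ?powR_ge0.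
Qed.

End fofana_maximal.

(** * The fractional maximal function *)

Section fractional.
Context {R : realType} {d : nat}.
Local Notation T := (Rd R d).
Local Notation mu := (@lebesgue_Rd R d).
Implicit Types (h : T -> R) (phi : R -> R).

Lemma recip_fin (p : R) : 0 < p -> recip p%:E = p^-1.
Proof. by move=> p0; rewrite /recip inver gt_eqF. Qed.

Lemma recipy : recip (+oo%E : \bar R) = 0.
Proof. by rewrite /recip invey. Qed.

Lemma integral_eball_le_powR (q beta C' : R) (p : \bar R) phi :
  (0 < d)%N -> 1 < q -> (0 < p)%E -> (forall t, 0 < t -> 0 < phi t) ->
  0 < C' -> (forall t, 0 < t -> phi t <= C' * t `^ beta) ->
  exists2 K : R, 0 < K & forall h (F : R),
    measurable_fun [set: T] h -> (forall x, 0 <= h x) -> 0 <= F ->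
    (forall t, 0 < t -> (amalgam_norm q%:E p t (EFin \o h) <=
      (F * (phi t * t `^ (d%:R / q + d%:R * recip p)))%:E)%E) ->
    forall z t, 0 < t ->
      (\int[mu]_(x in eball z t) (h x)%:E <= (K * F * t `^ beta * t ^+ d)%:E)%E.
Proof.
move=> d0 q1 p0 phi0 C'0 phiC; have q0 : 0 < q by exact: lt_trans q1.
set e := d%:R * recip p.
have dV0 : 0 < d%:R^-1 :> R by rewrite invr_gt0 ltr0n.
(* The powers of 2 come from the amalgam bound at radius 2t, and the power of 1 / d from the lower
   bound (t / d)^d on the volume of a ball. *)
pose K1 : R := C' * 2 `^ beta * 2 `^ (d%:R / q + e) * d%:R^-1 `^ (- e).
have K10 : 0 < K1 by rewrite !mulr_gt0 ?powR_gt0.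
have c0 : 0 < 2 ^+ d + 1 :> R by rewrite ltr_wpDl// exprn_ge0.
exists ((2 ^+ d + 1) * K1) => [|h F mh h0 F0 hF z t t0]; first exact: mulr_gt0.
have t20 : 0 < 2 * t by rewrite mulr_gt0.
have dt0 : 0 < d%:R^-1 * t by rewrite mulr_gt0.
have B0 : 0 <= F * (phi (2 * t) * (2 * t) `^ (d%:R / q + e)).
  by rewrite !mulr_ge0 ?powR_ge0 ?(ltW (phi0 _ t20)).
have := Lnorm_eball_le_amalgam z d0 q0 p0 h0 mh t0 B0 (hF _ t20).
pose s := K1 * F * t `^ beta.
have s0 : 0 <= s by exact: mulr_ge0 (mulr_ge0 (ltW K10) F0) (powR_ge0 _ _).
move=> N1; have {}N1 : ((\int[mu]_(x in eball z t) (h x `^ q)%:E) `^ q^-1 <=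
    (s * t `^ (d%:R / q))%:E)%E.
  apply: (le_trans N1); rewrite lee_fin -/e.
  have -> : s * t `^ (d%:R / q) = F * (C' * (2 * t) `^ beta *
      (2 * t) `^ (d%:R / q + e)) * (d%:R^-1 * t) `^ (- e).
    rewrite /s /K1 !powRM ?(ltW t0) ?(ltW dV0)//.
    rewrite [t `^ (_ + _)]powRD; last by rewrite (gt_eqF t0) implybT.
    rewrite (powRN t); have : t `^ e != 0 by rewrite gt_eqF// powR_gt0.
    move: (t `^ e) (t `^ beta) (t `^ _) (2 `^ _) (2 `^ _) (_ `^ (- e)).
    by move=> a b c u v w a0; field.
  apply: ler_wpM2r; first exact: powR_ge0.
  apply: ler_wpM2l => //; apply: ler_wpM2r; first exact: powR_ge0.
  exact: phiC.
have N0 : (0 <= \int[mu]_(x in eball z t) (h x `^ q)%:E)%E.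
  by apply: integral_ge0 => x _; rewrite lee_fin powR_ge0.
have powd : t ^+ d = (t `^ (d%:R / q)) `^ q.
  by rewrite -powRrM divfK ?gt_eqF// powR_mulrn// ltW.
have : (\int[mu]_(x in eball z t) (h x `^ q)%:E <= (s `^ q * t ^+ d)%:E)%E.
  rewrite -[leLHS]poweRe1// (_ : 1 = q^-1 * q); last by rewrite mulVf ?gt_eqF.
  rewrite poweRrM powd -powRM ?powR_ge0// -poweR_EFin.
  apply: (gt0_ler_poweR _ _ _ N1); first exact: ltW.
  - by rewrite in_itv/= leey poweR_ge0.
  - by rewrite in_itv/= leey andbT lee_fin mulr_ge0 ?powR_ge0.
move=> /(integral_le_power_mean mh h0 q1 s0 t0) /le_trans; apply.
by rewrite lee_fin /s !mulrA.
Qed.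

(* Write [theta := - gamma / beta = 1 - tau].  An average of [h] over a ball of
   radius [r] is at most [G r^beta], so that, splitting it into powers [tau] and
   [theta], its product by [r^gamma] is at most
   [(ball_maximal h)^tau G^theta r^(gamma + beta theta)], free of [r]. *)
Lemma frac_maximal_le (gamma beta G : R) (f : T -> R[i]) h x :
  (0 < d)%N -> 0 < gamma -> beta < - gamma -> gamma <= d%:R ->
  (forall x, modulus f x = (h x)%:E) -> (forall x, 0 <= h x) -> 0 <= G ->
  (forall t, 0 < t -> (\int[mu]_(x in eball x t) (h x)%:E <=
    (G * t `^ beta * t ^+ d)%:E)%E) ->
  (frac_maximal gamma f x <= ((d%:R^-1 ^+ d) `^ (gamma / d%:R - 1) *
    G `^ (- (gamma / beta)))%:E * ball_maximal h x `^ (1 + gamma / beta))%E.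
Proof.
move=> d0 gamma0 hbeta gammad fh h0 G0 hG.
have beta0 : beta < 0 by lra.
have g0 : 0 < - (gamma / beta) by rewrite -mulrN -invrN divr_gt0// oppr_gt0.
have g1 : 0 < 1 + gamma / beta.
  rewrite -(opprK (gamma / beta)) subr_gt0 -mulrN -invrN ltr_pdivrMr ?oppr_gt0//.
  by rewrite mul1r ltrNr.
apply: ge_ereal_sup => _ [r /= + <-]; rewrite in_itv/= andbT => r0.
have dn0 : 0 < d%:R :> R by rewrite ltr0n.
have rd0 : 0 < r ^+ d by rewrite exprn_gt0.
(* Since this exponent is not positive, the power of the volume in [frac_maximal] is bounded above
   through a lower bound on the volume. *)
have ee0 : gamma / d%:R - 1 <= 0 by rewrite subr_le0 ler_pdivrMr// mul1r.
set I := (\int[mu]_(y in eball x r) modulus f y)%E.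
have IE : I = (\int[mu]_(y in eball x r) (h y)%:E)%E.
  by apply: eq_integral => y _; exact: fh.
have I0 : (0 <= I)%E by rewrite IE; apply: integral_ge0 => y _; rewrite lee_fin.
have b0 : (0 <= ball_maximal h x)%E by exact: ball_maximal_ge0.
have IG : (I <= (G * r `^ beta * r ^+ d)%:E)%E by rewrite IE; exact: hG.
have Ib : (I <= (r ^+ d)%:E * ball_maximal h x)%E.
  by rewrite IE; exact: ball_average_le_maximal.
have m_fin : mu (eball x r) \is a fin_num.
  rewrite ge0_fin_numE ?measure_ge0//.
  by apply: le_lt_trans (eball_measure_le x r0) _; rewrite ltry.
have mE : (mu (eball x r) `^ (gamma / d%:R - 1) <=
    ((d%:R^-1 ^+ d) `^ (gamma / d%:R - 1) * r `^ (gamma - d%:R))%:E)%E.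
  have := eball_measure_ge x d0 r0; rewrite -(fineK m_fin) lee_fin => mge.
  have dr0 : 0 < (d%:R^-1 * r) ^+ d by rewrite exprn_gt0// mulr_gt0// invr_gt0.
  rewrite poweR_EFin lee_fin -(opprK (gamma / _ - 1)) powRN.
  apply: (@le_trans _ _ (((d%:R^-1 * r) ^+ d) `^ (- (gamma / d%:R - 1)))^-1).
    rewrite lef_pV2 ?posrE ?powR_gt0//; last exact: lt_le_trans mge.
    apply: ge0_ler_powR; rewrite ?nnegrE ?oppr_ge0//; first exact: ltW.
    by rewrite fine_ge0.
  rewrite -powRN opprK exprMn powRM ?exprn_ge0 ?invr_ge0 ?(ltW dn0) ?(ltW r0)//.
  rewrite -(powR_mulrn _ (ltW r0)) -powRrM.
  by rewrite mulrBr mulr1 mulrCA divff ?mulr1// gt_eqF.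
have II : (I <= ((r ^+ d) `^ (1 + gamma / beta))%:E *
    ball_maximal h x `^ (1 + gamma / beta) *
    ((G * r `^ beta * r ^+ d) `^ (- (gamma / beta)))%:E)%E.
  have Ifin : I \is a fin_num.
    by rewrite ge0_fin_numE//; apply: le_lt_trans IG _; rewrite ltry.
  have -> : I = (I `^ (1 + gamma / beta) * I `^ (- (gamma / beta)))%E.
    rewrite -(fineK Ifin) !poweR_EFin -EFinM -powRD ?addrK ?powRr1 ?fine_ge0//.
    by rewrite ?addrK oner_eq0.
  apply: lee_pmul; rewrite ?poweR_ge0//.
    rewrite -poweR_EFin -poweRM ?lee_fin ?(ltW rd0)//.
    apply: (gt0_ler_poweR _ _ _ Ib); first exact: ltW.
    - by rewrite in_itv/= leey andbT.
    - by rewrite in_itv/= leey andbT mule_ge0// lee_fin ltW.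
  rewrite -poweR_EFin; apply: (gt0_ler_poweR _ _ _ IG); first exact: ltW.
  - by rewrite in_itv/= leey andbT.
  - by rewrite in_itv/= leey andbT lee_fin !mulr_ge0 ?powR_ge0 ?(ltW rd0).
apply: le_trans (lee_pmul _ _ mE II) _; rewrite ?poweR_ge0//.
rewrite (muleC _ (ball_maximal _ _ `^ _)%E) -muleA -EFinM muleCA -EFinM muleC.
apply: lee_wpmul2r; first exact: poweR_ge0.
rewrite lee_fin -(powR_mulrn _ (ltW r0)) -!powRrM.
rewrite powRM ?mulr_ge0 ?powR_ge0// powRM ?powR_ge0// -!powRrM.
have -> : (d%:R^-1 ^+ d) `^ (gamma / d%:R - 1) * r `^ (gamma - d%:R) *
    (r `^ (d%:R * (1 + gamma / beta)) * (G `^ (- (gamma / beta)) *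
     r `^ (beta * - (gamma / beta)) * r `^ (d%:R * - (gamma / beta)))) =
    (d%:R^-1 ^+ d) `^ (gamma / d%:R - 1) * G `^ (- (gamma / beta)) *
    (r `^ (gamma - d%:R) * r `^ (d%:R * (1 + gamma / beta)) *
     r `^ (beta * - (gamma / beta)) * r `^ (d%:R * - (gamma / beta))) by ring.
have rD a b : r `^ a * r `^ b = r `^ (a + b).
  by rewrite powRD// (gt_eqF r0) implybT.
rewrite !rD (_ : gamma - d%:R + d%:R * (1 + gamma / beta) +
    beta * - (gamma / beta) + d%:R * - (gamma / beta) = 0) ?powRr0 ?mulr1//.
by field; rewrite lt_eqF.
Qed.

Lemma measurable_normc (f : T -> R[i]) : L0 f ->
  measurable_fun [set: T] (fun x => ComplexField.Normc.normc (f x)).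
Proof.
move=> [mRe mIm].
have -> : (fun x => ComplexField.Normc.normc (f x)) = (fun x =>
    (complex.Re (f x) ^+ 2 + complex.Im (f x) ^+ 2) `^ 2^-1).
  apply/funext => x; rewrite powR12_sqrt ?addr_ge0 ?sqr_ge0//.
  by case: (f x).
apply: (measurableT_comp (measurable_powR 2^-1)).
by apply: measurable_funD; exact: measurable_funX.
Qed.

Lemma normc_ge0 (z : R[i]) : 0 <= ComplexField.Normc.normc z.
Proof. by case: z => a b; rewrite /= sqrtr_ge0. Qed.

End fractional.

Theorem corollary3p3 (R : realType) (d : nat) (q : R) (p : \bar R)
    (gamma beta : R) (phi : R -> R)
    (hd : (0 < d)%N)
    (hq : 1 < q) (hqp : (q%:E <= p)%E)
    (hgamma0 : 0 < gamma) (hgamma : gamma < d%:R / q)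
    (hbeta0 : - (d%:R / q) <= beta) (hbeta : beta < - gamma)
    (hphi : Gclass d q%:E p phi)
    (hint : exists2 C : R, 0 < C & forall r : R, 0 < r ->
      (\int[lebesgue_measure]_(t in `]r, +oo[)
          (phi t `^ q * t `^ (d%:R * q * recip p - 1))%:E
        <= (C * (phi r `^ q * r `^ (d%:R * q * recip p)))%:E)%E)
    (hpow : exists2 C' : R, 0 < C' & forall r : R, 0 < r ->
      phi r <= C' * r `^ beta) :
  let pbar : \bar R := (p^-1 * (1 + gamma / beta)%:E)^-1%E in
  let qbar : R := (q^-1 * (1 + gamma / beta))^-1 in
  let psi : R -> R := fun r => phi r `^ (q / qbar) in
  exists2 K : R, 0 < K &
    forall f : Rd R d -> R[i], fofana q%:E p phi f ->
      (fofana_norm qbar%:E pbar psi (frac_maximal gamma f)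
        <= K%:E * fofana_norm q%:E p phi (modulus f))%E.
Proof.
move=> pbar qbar psi.
have q0 : 0 < q by exact: lt_trans hq.
have p0 : (0 < p)%E by apply: lt_le_trans hqp; rewrite lte_fin.
have beta0 : beta < 0 by lra.
have d0 : 0 < d%:R :> R by rewrite ltr0n.
set tau := 1 + gamma / beta; set theta := - (gamma / beta).
have theta0 : 0 < theta.
  by rewrite /theta -mulrN -invrN divr_gt0// oppr_gt0.
have tau0 : 0 < tau.
  rewrite /tau -(opprK (gamma / beta)) subr_gt0 -mulrN -invrN ltr_pdivrMr ?oppr_gt0//.
  by rewrite mul1r ltrNr.
have taut : theta + tau = 1 by rewrite /theta /tau addrCA addNr addr0.
have gammad : gamma <= d%:R.
  by apply/ltW/(lt_le_trans hgamma); rewrite ler_pdivrMr// ler_peMr// ltW.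
have qq : q / qbar = tau by rewrite /qbar invrK mulrA divff ?gt_eqF// mul1r.
have recipq : recip q%:E = q^-1 by exact: recip_fin.
have qbarE : (q%:E^-1 * tau%:E)^-1%E = qbar%:E.
  by rewrite inver (gt_eqF q0) -EFinM inver mulf_eq0 invr_eq0 !gt_eqF.
have qbar0 : 0 < qbar by rewrite /qbar invr_gt0 mulr_gt0// invr_gt0.
have recipqbar : recip qbar%:E = tau / q.
  by rewrite recip_fin// /qbar invrK mulrC.
have recippbar : recip pbar = tau * recip p.
  rewrite /pbar -/tau; case: p p0 {hqp hphi hint pbar} => [p| |//] p0.
    have {}p0 : 0 < p by rewrite -lte_fin.
    rewrite recip_fin// inver (gt_eqF p0) -EFinM inver gt_eqF ?mulr_gt0 ?invr_gt0//.
    by rewrite recip_fin ?invrK 1?mulrC// invr_gt0 mulr_gt0// invr_gt0.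
  by rewrite invey mul0e inve0 recipy mulr0.
have [phi0 [C1 C10 dec] _] := hphi.
have [C C_gt0 intphi] := hint; have [C' C'0 phiC] := hpow.
pose a := d%:R / q + d%:R * recip p.
(* Finite and infinite [p] are merged into one statement; for p = +oo the weight t^(d/p) is 1, and
   [dec] says that phi itself is almost decreasing. *)
have [K K0 maxK] : exists2 K : R, 0 < K & forall (h : Rd R d -> R) (F r : R),
    measurable_fun [set: Rd R d] h -> (forall x, 0 <= h x) -> 0 <= F -> 0 < r ->
    (forall t, 0 < t -> (amalgam_norm q%:E p t (EFin \o h) <=
      (F * (phi t * t `^ a))%:E)%E) ->
    (amalgam_norm q%:E p r (ball_maximal h) <=
      (K * F * (phi r * r `^ a))%:E)%E.
  rewrite /a; case: p p0 hqp dec intphi {hphi hint pbar recippbar a} => [p| |//].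
    rewrite lte_fin lee_fin => p0 qp; rewrite recip_fin// => dec intphi.
    apply: (@amalgam_ball_maximal_fin R d q p (2 * C1 `^ p * C) phi) => //.
      by rewrite !mulr_gt0// powR_gt0.
    move=> r n r0; apply: (growth_dyadic_sum q0 C10 C_gt0 phi0 dec) => // s s0.
    by rewrite (mulrAC _ q) in intphi; exact: intphi.
  move=> _ _; rewrite recipy mulr0 addr0 => dec _.
  apply: (@amalgam_ball_maximal_oo R d q C1 phi) => // r s r0 rs.
  by have := dec r s r0 rs; rewrite !powRr0 !mulr1.
have [A A0 avg] := integral_eball_le_powR hd hq p0 phi0 C'0 phiC.
pose c : R := (d%:R^-1 ^+ d) `^ (gamma / d%:R - 1).
have c0 : 0 < c by rewrite powR_gt0// exprn_gt0// invr_gt0.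
exists (c * A `^ theta * K `^ tau).
  exact: mulr_gt0 (mulr_gt0 c0 (powR_gt0 _ A0)) (powR_gt0 _ K0).
move=> f [fL0 fF].
pose h (x : Rd R d) : R := ComplexField.Normc.normc (f x).
have mh : measurable_fun [set: Rd R d] h by exact: measurable_normc.
have h0 x : 0 <= h x by exact: normc_ge0.
have F_ge0 : (0 <= fofana_norm q%:E p phi (modulus f))%E.
  apply: le_trans (ereal_sup_ubound _); last first.
    by exists 1 => //=; rewrite in_itv/= ltr01.
  by rewrite mule_ge0 ?Lnorm_ge0// lee_fin mulr_ge0 ?powR_ge0// invr_ge0 ltW// phi0.
have F_fin : fofana_norm q%:E p phi (modulus f) \is a fin_num.
  by rewrite ge0_fin_numE.
rewrite -(fineK F_fin); set F := fine _.
have F0 : 0 <= F by rewrite fine_ge0.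
have ca t : 0 < t -> 0 < phi t * t `^ a.
  by move=> t0; rewrite mulr_gt0 ?phi0 ?powR_gt0.
have hF t : 0 < t -> (amalgam_norm q%:E p t (EFin \o h) <=
    (F * (phi t * t `^ a))%:E)%E.
  move=> t0; rewrite (mulrC F) EFinM -lee_pdivrMl ?ca// /F fineK//.
  apply: ereal_sup_ubound; exists t; first by rewrite /= in_itv/= t0.
  congr ((_%:E) * _)%E; rewrite invfM; congr (_ * _).
  by rewrite -powRN /a recipq -opprD mulrN mulrDr.
have avg_h z t : 0 < t -> (\int[@lebesgue_Rd R d]_(x in eball z t) (h x)%:E <=
    (A * F * t `^ beta * t ^+ d)%:E)%E.
  by move=> t0; exact: avg mh h0 F0 hF z t t0.
have AF0 : 0 <= A * F by rewrite mulr_ge0// ltW.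
have Mle x : (frac_maximal gamma f x <=
    (c * (A * F) `^ theta)%:E * ball_maximal h x `^ tau)%E.
  by apply: frac_maximal_le => // t t0; exact: avg_h.
have M0 x : (0 <= frac_maximal gamma f x)%E.
  apply: le_trans (ereal_sup_ubound _); last first.
    by exists 1 => //=; rewrite in_itv/= ltr01.
  rewrite mule_ge0 ?poweR_ge0//; apply: integral_ge0 => y _; rewrite lee_fin.
  exact: h0.
pose cF := c * (A * F) `^ theta.
have cF0 : 0 <= cF by exact: mulr_ge0 (ltW c0) (powR_ge0 _ _).
apply: ge_ereal_sup => _ [r /= + <-]; rewrite in_itv/= andbT => r0.
(* [Lnorm_le_powR] is applied to the norm in y with exponent p and constant [cF]; its pointwise
   hypothesis is the same lemma for the norm over B(y, r) with exponent q. *)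
have outer : (amalgam_norm qbar%:E pbar r (frac_maximal gamma f) <=
    cF%:E * (amalgam_norm q%:E p r (ball_maximal h)) `^ tau)%E.
  apply: Lnorm_le_powR => // [y|y]; first exact: Lnorm_ge0.
  rewrite gee0_abs ?Lnorm_ge0// -qbarE.
  apply: Lnorm_le_powR => // [x|x].
  - by rewrite /patch; case: ifP => // _; exact: ball_maximal_ge0.
  - rewrite /patch; case: ifP => _; first by rewrite gee0_abs//; exact: Mle.
    by rewrite abse0 mule_ge0 ?lee_fin ?poweR_ge0.
have KF0 : 0 <= K * F * (phi r * r `^ a).
  by rewrite mulr_ge0 ?(ltW (ca _ r0))// mulr_ge0// ltW.
have {}outer : (amalgam_norm qbar%:E pbar r (frac_maximal gamma f) <=
    (cF * (K * F * (phi r * r `^ a)) `^ tau)%:E)%E.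
  apply: (le_trans outer); rewrite [leRHS]EFinM; apply: lee_wpmul2l => //.
  rewrite -poweR_EFin; apply: (gt0_ler_poweR _ _ _ (maxK h F r mh h0 F0 r0 hF)).
  - exact: ltW.
  - by rewrite in_itv/= leey andbT; exact: Lnorm_ge0.
  - by rewrite in_itv/= leey andbT.
have psi0 : 0 < psi r by rewrite powR_gt0// phi0.
apply: (le_trans (lee_wpmul2l _ outer)).
  by rewrite lee_fin mulr_ge0 ?powR_ge0// invr_ge0 ltW.
rewrite -!EFinM lee_fin /psi qq recipqbar recippbar /cF.
have -> : d%:R * (- (tau / q) - tau * recip p) = - (a * tau).
  by rewrite /a; ring.
rewrite powRN (powRrM r) -invfM -(powRM _ (ltW (phi0 _ r0)))// ?powR_ge0//.
rewrite (powRM _ _ (ltW (ca _ r0))); last by rewrite mulr_ge0// ltW.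
rewrite !(powRM _ _ F0) ?(ltW A0) ?(ltW K0)//.
(* The power theta of the norm comes from the pointwise estimate and the power tau from the maximal
   bound; as theta + tau = 1, the final bound is linear in the norm. *)
have F1 : F `^ theta * F `^ tau = F.
  by rewrite -powRD taut ?powRr1// oner_eq0.
have := powR_gt0 tau (ca _ r0); move: ((phi r * r `^ a) `^ tau) => w w0.
rewrite -[in leRHS]F1 le_eqVlt; apply/orP; left; apply/eqP.
by field; rewrite gt_eqF.
Qed.
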